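(* Let $\mu,\nu\in\mathcal P_2(\mathbb R^n)$ and let $\pi\in\Pi(\mu,\nu)$ be an arbitrary coupling. Let $(X_t,Y_t)_{t\ge0}$ be the solution of the orthogonal coupling dynamics (OCD) $$\dot X_t=-\nabla_xc(X_t,Y_t)+\mathbb E_{p_t}[\nabla_xc(X_t,Y_t)\mid X_t],\qquad \dot Y_t=-\nabla_yc(X_t,Y_t)+\mathbb E_{p_t}[\nabla_yc(X_t,Y_t)\mid Y_t],$$ with initial condition $(X_0,Y_0)\sim\pi$, where $p_t$ is the joint law of $(X_t,Y_t)$. Suppose the Regularity Assumption (stated in the context) holds. Then $$\frac{d}{dt}\,\mathbb E[c(X_t,Y_t)]\le 0 .$$
   Context: Notation. $\mathcal P_2(\mathbb R^m)$ is the set of Borel probability measures on $\mathbb R^m$ with finite second moment; $\Pi(\mu,\nu)$ is the set of joint measures in $\mathcal P_2(\mathbb R^n\times\mathbb R^n)$ with marginals $\mu,\nu\in\mathcal P_2(\mathbb R^n)$. $c:\mathbb R^{2n}\to\mathbb R$ is a non-negative smooth cost function. $X_t,Y_t$ are $\mathbb R^n$-valued square-integrable random variables on a common probability space. Regularity Assumption. For each $t\ge0$ the joint law $p_t$ of $(X_t,Y_t)$ admits a Lebesgue density $\rho_t\in L^1(\mathbb R^{2n})$ with finite second moment. Moreover: (1) $t\mapsto\rho_t$ is weakly continuous in $L^1$. (2) The velocity field $v_t=(v_{1,t},v_{2,t})$ (the right-hand side of the dynamics, as a function of $(x,y)$) satisfies $v_t\in L^2(p_t)$ and $v_t\rho_t\in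 L^1(\mathbb R^{2n})$. (3) $c\in C^1(\mathbb R^{2n})$ and $|\nabla_xc(x,y)|+|\nabla_yc(x,y)|\le C(1+|x|+|y|)$ for some constant $C$. (4) Conditional expectations such as $\mathbb E_{p_t}[\nabla_xc(X_t,Y_t)\mid X_t=x]$ exist in $L^2(\mu)$ and define measurable functions (and likewise for $y$ with $L^2(\nu)$). (5) There is $L>0$ such that for all $p,q\in\Pi(\mu,\nu)$, $\|\mathbb E_p[\nabla_xc(X,Y)\mid X]-\mathbb E_q[\nabla_xc(X,Y)\mid X]\|_{L^2(\mu)}\le L\,W_2(p,q)$, where $W_2$ is the 2-Wasserstein distance, and similarly for the conditional expectation with respect to $Y$. *)

(* Defs.v *)
From HB Require Import structures.
From mathcomp Require Import all_boot all_order all_algebra.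
From mathcomp Require Import all_classical all_reals all_analysis measurable_realfun.
Import Order.TTheory GRing.Theory Num.Theory.
Import numFieldNormedType.Exports.

Set Implicit Arguments.
Unset Strict Implicit.
Unset Printing Implicit Defensive.

Local Open Scope classical_set_scope.
Local Open Scope ring_scope.

Definition borel_mx_display : measure_display. Proof. exact. Qed.

(* Matrices, hence row vectors, carry their Borel sigma-algebra. *)
HB.instance Definition _ (R : realType) (m n : nat) :=
  @isMeasurable.Build borel_mx_display 'M[R]_(m, n)
    <<s @open 'M[R]_(m, n) >> (@sigma_algebra0 _ setT _)
    (@sigma_algebraC _ _) (@sigma_algebra_bigcup _ setT _).

Lemma measurable_coord (R : realType) (m n : nat) (i : 'I_m) (j : 'I_n) :
  measurable_fun setT (fun A : 'M[R]_(m, n) => A i j).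
Proof.
apply: (measurability _ (RGenOpens.measurableE R)).
move=> _ [_ [a [b ->]] <-]; rewrite setTI; apply: sub_sigma_algebra.
apply: open_comp; last exact: interval_open.
by move=> A _; exact: coord_continuous.
Qed.

(* Open sets are countable unions of rational boxes, so measurability into
   matrices can be checked coordinatewise. *)
Lemma measurable_fun_mx (R : realType) (m n : nat) (d : measure_display)
    (T : measurableType d) (f : T -> 'M[R]_(m, n)) :
  (forall i j, measurable_fun setT (fun x => f x i j)) ->
  measurable_fun setT f.
Proof.
move=> mf.
apply: (measurability (@open 'M[R]_(m, n))) => // _ [U oU <-]; rewrite setTI.
pose B (q : 'M[rat]_(m, n) * nat) : set 'M[R]_(m, n) :=
  [set M | forall i j, `|ratr (q.1 i j) - M i j| < q.2.+1%:R^-1].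
pose F q : set T := if pselect (B q `<=` U) then f @^-1` B q else set0.
have -> : f @^-1` U = \bigcup_q F q.
  apply/seteqP; split => [x Ux|x [q _]]; last first.
    by rewrite /F; case: pselect => // BU /= Bx; exact: BU.
  have /nbhs_ballP[e /= e0 eU] : nbhs (f x) U by exact: open_nbhs_nbhs.
  have [k ke] : exists k : nat, k.+1%:R^-1 < e / 2.
    have e20 : 0 < e / 2 by rewrite divr_gt0.
    exists (Num.truncn (e / 2)^-1); rewrite invf_plt ?posrE ?ltr0n//.
    exact: truncnS_gt.
  have k0 : 0 < k.+1%:R^-1 :> R by rewrite invr_gt0 ltr0n.
  have Hq i j : {q : rat | `|ratr q - f x i j| < k.+1%:R^-1}.
    apply: cid; have [] := @rat_in_itvoo R (f x i j - k.+1%:R^-1) (f x i j + k.+1%:R^-1).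
      by rewrite ltrBlDr -addrA ltrDl addr_gt0.
    by move=> q; rewrite in_itv/= => /andP[q1 q2]; exists q; rewrite ltr_distl q1 q2.
  exists ((\matrix_(i, j) sval (Hq i j)), k) => //.
  rewrite /F; case: pselect => [_|] /=.
    by move=> i j; rewrite mxE; case: (Hq i j).
  case=> M BM; apply: eU; split => // i j.
  rewrite /ball /= (_ : f x i j - M i j =
    (ratr (sval (Hq i j)) - M i j) - (ratr (sval (Hq i j)) - f x i j)); last first.
    by rewrite opprB [RHS]addrC addrA subrK.
  rewrite (le_lt_trans (ler_normB _ _))// (splitr e) ltrD//.
    by rewrite (lt_trans _ ke)//; have := BM i j; rewrite /= mxE.
  by rewrite (lt_trans _ ke)//; case: (Hq i j).
apply: countable_bigcupT_measurable => [|q]; first exact: countableP.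
rewrite /F; case: pselect => [?|?] /=; last exact: measurable0.
rewrite (_ : _ @^-1` _ = \bigcap_(i in [set: 'I_m]) \bigcap_(j in [set: 'I_n])
  ((fun x => f x i j) @^-1` [set y | `|ratr (q.1 i j) - y| < q.2.+1%:R^-1])).
  apply: fin_bigcap_measurable => // i _; apply: fin_bigcap_measurable => // j _.
  rewrite -[X in measurable X]setTI; apply: mf => //.
  by apply: open_measurable; exact: (@ball_open _ R^o).
by apply/seteqP; split => x /= H; [move=> i _ j _; exact: H|move=> i j; exact: H].
Qed.

Section lebesgue_rV.
Context {R : realType}.

Definition row_cons (n : nat) (p : measurableTypeR R * 'rV[R]_n) : 'rV[R]_n.+1 :=
  \row_j (if unlift ord0 j is Some k then p.2 0 k else p.1).

Lemma measurable_row_cons (n : nat) : measurable_fun setT (@row_cons n).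
Proof.
apply: measurable_fun_mx => i j; rewrite /row_cons.
under eq_fun do rewrite mxE; case: unliftP => [k _|_].
  exact: (measurableT_comp (measurable_coord _ _) measurable_snd).
exact: measurable_fst.
Qed.

Section lebesgue_cons.
Variables (n : nat) (m : {sigma_finite_measure set 'rV[R]_n -> \bar R}).

Definition lebesgue_cons : set 'rV[R]_n.+1 -> \bar R :=
  pushforward (lebesgue_measure \x m)%E (@row_cons n).

Let lebesgue_cons0 : lebesgue_cons set0 = 0%E.
Proof. by rewrite /lebesgue_cons /pushforward preimage_set0 measure0. Qed.

Let lebesgue_cons_ge0 A : (0 <= lebesgue_cons A)%E.
Proof. by rewrite /lebesgue_cons /pushforward measure_ge0. Qed.

Let lebesgue_cons_sigma_additive : semi_sigma_additive lebesgue_cons.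
Proof.
move=> F mF tF mUF; rewrite /lebesgue_cons /pushforward preimage_bigcup.
have mP A : measurable A -> measurable (@row_cons n @^-1` A).
  by move=> mA; rewrite -[X in measurable X]setTI; exact: measurable_row_cons.
apply: measure_semi_sigma_additive.
- by move=> i; exact: mP.
- apply/trivIsetP => /= i j _ _ ij; rewrite -preimage_setI.
  by move/trivIsetP : tF => /(_ _ _ _ _ ij) ->//; rewrite preimage_set0.
- by rewrite -preimage_bigcup; exact: mP.
Qed.

HB.instance Definition _ := isMeasure.Build _ _ _ lebesgue_cons
  lebesgue_cons0 lebesgue_cons_ge0 lebesgue_cons_sigma_additive.

Let lebesgue_cons_sigma_finite : sigma_finite setT lebesgue_cons.
Proof.
have /sigma_finiteP[F [TF ndF Foo]] := sigma_finiteT (@lebesgue_measure R).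
have /sigma_finiteP[G [TG ndG Goo]] := sigma_finiteT m.
pose g (v : 'rV[R]_n.+1) := (v 0 0, \row_j v 0 (lift ord0 j) : 'rV[R]_n).
have gK p : g (row_cons p) = p.
  case: p => x y; rewrite /g /row_cons mxE unlift_none; congr pair.
  by apply/rowP => j; rewrite !mxE liftK.
have mg : measurable_fun setT g.
  apply: measurable_fun_pair; first exact: measurable_coord.
  apply: measurable_fun_mx => i j; under eq_fun do rewrite mxE.
  exact: measurable_coord.
exists (fun k => g @^-1` (F k `*` G k)).
  rewrite -preimage_bigcup (_ : \bigcup_k _ = setT) ?preimage_setT//.
  apply/seteqP; split => // -[x y] _.
  have [k _ Fkx] : (\bigcup_k F k) x by rewrite -TF.
  have [l _ Gly] : (\bigcup_k G k) y by rewrite -TG.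
  exists (maxn k l) => //; split.
    by move: x Fkx; exact/subsetPset/ndF/leq_maxl.
  by move: y Gly; exact/subsetPset/ndG/leq_maxr.
move=> k; have [mF ?] := Foo k; have [mG ?] := Goo k; split.
  by rewrite -[X in measurable X]setTI; apply: mg => //; exact: measurableX.
rewrite /lebesgue_cons /pushforward (_ : _ @^-1` _ = F k `*` G k); last first.
  rewrite -comp_preimage (_ : g \o _ = id) ?preimage_id//.
  by apply/funext => p; exact: gK.
by rewrite product_measure1E// lte_mul_pinfty// ge0_fin_numE.
Qed.

HB.instance Definition _ := Measure_isSigmaFinite.Build _ _ _
  lebesgue_cons lebesgue_cons_sigma_finite.

End lebesgue_cons.

(* Lebesgue measure on R^n, as the n-fold product of the one on R. *)
Fixpoint lebesgue_rV (n : nat) : {sigma_finite_measure set 'rV[R]_n -> \bar R} :=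
  match n with
  | 0 => dirac (0 : 'rV[R]_0)
  | k.+1 => lebesgue_cons (lebesgue_rV k)
  end.

End lebesgue_rV.

Section euclidean.
Context {R : realType} (n : nat).
Local Notation E := 'rV[R]_n.

(* The norm of the library on row vectors and on pairs is the sup norm;
   lengths and distances below are Euclidean. *)
Definition enorm (x : E) : R := Num.sqrt (\sum_i x 0 i ^+ 2).

Definition enorm2 (z : E * E) : R :=
  Num.sqrt (enorm z.1 ^+ 2 + enorm z.2 ^+ 2).

Definition lebesgue_pair : {measure set (E * E)%type -> \bar R} :=
  (lebesgue_rV n \x lebesgue_rV n)%E.

Definition gradx (c : E * E -> R) (z : E * E) : E :=
  \row_i 'D_(delta_mx 0 i, 0) c z.

Definition grady (c : E * E -> R) (z : E * E) : E :=
  \row_i 'D_(0, delta_mx 0 i) c z.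

Definition C1 (c : E * E -> R) : Prop :=
  [/\ forall z, differentiable c z, continuous (gradx c)
    & continuous (grady c)].

End euclidean.

Section couplings.
Context {R : realType}.

Definition finite_second_moment (d : measure_display) (T : measurableType d)
    (mu : {measure set T -> \bar R}) (len : T -> R) : Prop :=
  (\int[mu]_x (len x ^+ 2)%:E < +oo)%E.

Definition is_coupling (d1 d2 : measure_display) (T1 : measurableType d1)
    (T2 : measurableType d2) (p : probability T1 R) (q : probability T2 R)
    (g : probability (T1 * T2)%type R) : Prop :=
  (forall A, measurable A -> g (fst @^-1` A) = p A) /\
  (forall B, measurable B -> g (snd @^-1` B) = q B).

Context (n : nat).
Local Notation E := 'rV[R]_n.

Definition Pi (mu nu : probability E R) (p : probability (E * E)%type R) :=
  is_coupling mu nu p /\ finite_second_moment p (@enorm2 R n).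

Definition W2 (p q : probability (E * E)%type R) : \bar R :=
  ((ereal_inf [set \int[g]_w (enorm2 (w.1 - w.2) ^+ 2)%:E
      | g in [set g | is_coupling p q g]]) `^ 2^-1)%E.

(* m is a version of x |-> E_p[g | pr = x]; pr is fst or snd below. *)
Definition is_cond_exp (p : probability (E * E)%type R) (g : E * E -> E)
    (pr : E * E -> E) (m : E -> E) : Prop :=
  [/\ measurable_fun setT m,
      forall i, p.-integrable setT (fun z => (g z 0 i)%:E),
      forall i, p.-integrable setT (fun z => (m (pr z) 0 i)%:E)
    & forall i B, measurable B ->
        (\int[p]_(z in pr @^-1` B) (m (pr z) 0 i)%:E
         = \int[p]_(z in pr @^-1` B) (g z 0 i)%:E)%E].

Definition is_density (p : probability (E * E)%type R) (rho : E * E -> R) :=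
  [/\ forall z, 0 <= rho z,
      (lebesgue_pair n).-integrable setT (EFin \o rho)
    & forall A, measurable A ->
        p A = (\int[lebesgue_pair n]_(z in A) (rho z)%:E)%E].

End couplings.

Section joint_law.
Context {R : realType} (n : nat) (d : measure_display) (T : measurableType d).
Context (P : probability T R) (X Y : {RV P >-> 'rV[R]_n}).

Definition joint (w : T) : 'rV[R]_n * 'rV[R]_n := (X w, Y w).

Lemma measurable_joint : measurable_fun setT joint.
Proof. exact: measurable_fun_pair. Qed.

HB.instance Definition _ := isMeasurableFun.Build _ _ _ _ joint measurable_joint.

Definition joint_law : probability ('rV[R]_n * 'rV[R]_n)%type R :=
  distribution P joint.

End joint_law.

(* f has derivative l at t as a function on [0, +oo[: a two-sided derivative
   for t > 0, and the right derivative for t = 0. *)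
Definition has_derive_ge0 (R : realType) (V : normedModType R) (f : R -> V)
    (t : R) (l : V) : Prop :=
  h^-1 *: (f (t + h) - f t) @[h --> within [set h | 0 <= t + h] 0^'] --> l.

Section dynamics.
Context {R : realType} (n : nat).
Local Notation E := 'rV[R]_n.
Context (c : E * E -> R) (mu nu : probability E R).
Context (d : measure_display) (T : measurableType d) (P : probability T R).
Context (X Y : R -> {RV P >-> E}).

(* m1 t and m2 t stand for the conditional expectations given X_t and Y_t. *)
Context (m1 m2 : R -> E -> E).

Definition velocity (t : R) (z : E * E) : E * E :=
  (- gradx c z + m1 t z.1, - grady c z + m2 t z.2).

Record OCD_solution : Prop := {
  OCD_square_integrable : forall t, 0 <= t ->
    finite_second_moment P (fun w => enorm (X t w)) /\
    finite_second_moment P (fun w => enorm (Y t w));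
  OCD_cond_exp : forall t, 0 <= t ->
    is_cond_exp (joint_law (X t) (Y t)) (gradx c) fst (m1 t) /\
    is_cond_exp (joint_law (X t) (Y t)) (grady c) snd (m2 t);
  OCD_ode : {ae P, forall w, forall t, 0 <= t ->
    has_derive_ge0 (fun s => X s w) t (velocity t (X t w, Y t w)).1 /\
    has_derive_ge0 (fun s => Y s w) t (velocity t (X t w, Y t w)).2}
}.

Record regularity (rho : R -> E * E -> R) : Prop := {
  reg_density : forall t, 0 <= t ->
    is_density (joint_law (X t) (Y t)) (rho t) /\
    (\int[lebesgue_pair n]_z (enorm2 z ^+ 2 * rho t z)%:E < +oo)%E;
  (* weak continuity in L^1, tested against L^oo *)
  reg_weak_continuous : forall psi : E * E -> R, measurable_fun setT psi ->
    (exists M, forall z, `|psi z| <= M) ->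
    {within `[0, +oo[,
      continuous (fun t => \int[lebesgue_pair n]_z (psi z * rho t z))};
  reg_velocity : forall t, 0 <= t ->
    ('N[joint_law (X t) (Y t)]_2%:E[EFin \o (fun z => enorm2 (velocity t z))]
      < +oo)%E /\
    (lebesgue_pair n).-integrable setT
      (fun z => (enorm2 (velocity t z) * rho t z)%:E);
  reg_C1 : C1 c;
  reg_growth : exists C, forall x y,
    enorm (gradx c (x, y)) + enorm (grady c (x, y))
    <= C * (1 + enorm x + enorm y);
  reg_cond_exp_L2 : forall t, 0 <= t ->
    ('N[mu]_2%:E[EFin \o (fun x => enorm (m1 t x))] < +oo)%E /\
    ('N[nu]_2%:E[EFin \o (fun y => enorm (m2 t y))] < +oo)%E;
  reg_lipschitz : exists2 L, 0 < L &
    forall p q, Pi mu nu p -> Pi mu nu q ->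
    (forall mp mq, is_cond_exp p (gradx c) fst mp ->
       is_cond_exp q (gradx c) fst mq ->
       ('N[mu]_2%:E[EFin \o (fun x => enorm (mp x - mq x))]
         <= L%:E * W2 p q)%E) /\
    (forall mp mq, is_cond_exp p (grady c) snd mp ->
       is_cond_exp q (grady c) snd mq ->
       ('N[nu]_2%:E[EFin \o (fun y => enorm (mp y - mq y))]
         <= L%:E * W2 p q)%E)
}.

End dynamics.

(* Main.v *)
Require Import Defs.
From mathcomp Require Import all_boot all_order all_algebra.
From mathcomp Require Import all_classical all_reals all_analysis measurable_realfun.
From mathcomp Require Import ring lra.
Import Order.TTheory GRing.Theory Num.Theory.
Import numFieldNormedType.Exports.

Set Implicit Arguments.
Unset Strict Implicit.
Unset Printing Implicit Defensive.

Local Open Scope classical_set_scope.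
Local Open Scope ring_scope.

(** Let [V] be the velocity of the pair [Z = (X, Y)].  Conditioning [V] on [X]
    kills its first block and conditioning on [Y] kills its second block, so
    [V] is orthogonal to the conditional means that it contains; hence
    [E (grad c . V) = - E |V|^2 <= 0] and [E |V|^2 <= E |grad c|^2], and the
    latter is at most [K (1 + E |Z|^2)] by the linear growth of the gradient.
    The whole difficulty is to differentiate [E c(Z)] under the expectation, at
    every single time, when the paths are only known to be differentiable and
    no bound on the second moments is uniform in time.

    - From paths to integrals: a function that is differentiable at every point
      and whose derivative is at most [h >= 0] increases by at most the integral
      of [h] ([derive_le_integral]), even if its derivative is not integrable.
      With Tonelli this bounds expected increments
      ([Rexpectation_increment_le]).
    - On a time interval where [E |Z|^2] is bounded, two consequences follow for
      each coordinate [x] with velocity [v].  Its displacement is Lipschitz in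
      L2 ([displacement_sq_le]).  And since [v] is orthogonal to bounded
      functions of [x], the expectation of a bounded smooth truncation of [x^2]
      is constant ([satsq_expectation_eq]), so that [E x^2] itself is constant.
    - [E |Z|^2] is finite at each time, lower semicontinuous in time by Fatou's
      lemma, and takes equal values at the two ends of any interval in whose
      interior it is locally bounded.  By a Baire category argument such a
      function is locally bounded everywhere ([lsc_bounded_near]).  Therefore
      [Z] is locally Lipschitz in L2 ([locally_lipschitz_L2]).
    - The mean value theorem writes the difference quotient of [c(Z)] as a
      gradient, bounded in L2 by a fixed function plus a vanishing term, times
      a quotient bounded in L2.  Young's inequality and dominated convergence
      then give the limit [E (grad c . V)] ([cost_quotient_cvg]). *)
(** * Derivatives and continuous induction *)

Lemma is_derive_nbhs (R : realType) (f : R -> R) (t l eps : R) :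
  is_derive t 1 f l -> 0 < eps ->
  \forall s \near t, `|f s - f t - l * (s - t)| <= eps * `|s - t|.
Proof.
move=> [df dfl] e0.
have /cvgrPdist_le /(_ _ e0) : h^-1 *: (f (h + t) - f t) @[h --> 0^'] --> l.
  by move: df; rewrite /derivable => /cvgP;
     rewrite -dfl /derive; under eq_fun do rewrite scaler1.
move=> /nbhs_ballP[d /= d0 dP].
near=> s.
have [->|st] := eqVneq s t; first by rewrite !subrr mulr0 subrr normr0 mulr0.
have st0 : s - t != 0 by rewrite subr_eq0.
have : `|l - (s - t)^-1 *: (f (s - t + t) - f t)| <= eps.
  apply: dP => //=; rewrite /ball /= sub0r normrN.
  near: s; exists d => //= y; rewrite /ball /= distrC.
  by [].
rewrite subrK => Hl.
rewrite distrC (_ : _ - _ = (s - t) * (l - (s - t)^-1 * (f s - f t))); last by field.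
by rewrite normrM mulrC ler_wpM2r.
Unshelve. all: end_near. Qed.

Lemma is_derive_continuous (R : realType) (f : R -> R) (t l : R) :
  is_derive t 1 f l -> {for t, continuous f}.
Proof. by move=> [+ _] => /derivable1_diffP/differentiable_continuous. Qed.

(** The set of points [y] of [a, b] at which [f y - f a <= H y] contains its
    supremum, by continuity of [f] and monotonicity of [H]; as each point before
    [b] can be passed, the supremum is [b]. *)
Lemma real_induction_le (R : realType) (f : R -> R) (H : R -> \bar R) (a b : R) :
  a <= b -> (forall t, a <= t <= b -> {for t, continuous f}) ->
  (forall s t, a <= s -> s <= t -> t <= b -> (H s <= H t)%E) -> (0 <= H a)%E ->
  (forall s, a <= s < b -> exists2 y, s < y <= b & ((f y - f s)%:E + H s <= H y)%E) ->
  ((f b - f a)%:E <= H b)%E.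
Proof.
move=> ab cf Hnd Ha Hstep.
pose S := [set y | a <= y <= b /\ ((f y - f a)%:E <= H y)%E].
have Sa : S a by split; rewrite ?lexx ?ab// subrr.
have supS : has_sup S.
  by split; [exists a|exists b => y [/andP[_ ?] _]].
pose s := sup S.
have as_ : a <= s by apply: ub_le_sup => //; exact: (proj2 supS).
have sb : s <= b by apply: ge_sup => [|y [/andP[_ ?] _]//]; exists a.
have Ss : S s.
  split; first by rewrite as_ sb.
  apply/lee_addgt0Pr => e e0.
  have /cvgrPdist_le/(_ _ e0) : f x @[x --> s] --> f s by apply: cf; rewrite as_ sb.
  move=> /nbhs_ballP[d /= d0 dP].
  have [y Sy sdy] := sup_adherent d0 supS.
  have ys : y <= s by apply: ub_le_sup => //; exact: (proj2 supS).
  have : `|f s - f y| <= e.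
    apply: dP; rewrite /ball/= ger0_norm ?subr_ge0//.
    by rewrite ltrBlDr addrC -ltrBlDr.
  move=> /ler_normlW fsy.
  case: Sy => /andP[ay yb] Hy.
  apply: (@le_trans _ _ ((f y - f a)%:E + e%:E)%E).
    by rewrite -EFinD lee_fin; lra.
  by rewrite leeD2r// (le_trans Hy)// Hnd.
have [sb'|] := ltP s b; last first.
  by move=> bs; case: Ss => _; rewrite (le_anti (introT andP (conj bs sb))).
have [|y /andP[sy yb] Hy] := Hstep s; first by rewrite as_ sb'.
suff : y <= s by rewrite leNgt sy.
apply: ub_le_sup; first exact: (proj2 supS).
split; first by rewrite yb (le_trans as_)// ltW.
apply: (@le_trans _ _ ((f y - f s)%:E + H s)%E); last first.
  exact: Hy.
rewrite (_ : f y - f a = (f y - f s) + (f s - f a)); last by lra.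
by rewrite EFinD leeD2l//; case: Ss.
Qed.

Lemma integral_cst_itvcc (R : realType) (a b k : R) : a <= b ->
  (\int[lebesgue_measure]_(_ in `[a, b]) k%:E = (k * (b - a))%:E)%E.
Proof.
move=> ab.
have lab : lebesgue_measure (`[a, b]%classic : set R) = (b - a)%:E.
  rewrite lebesgue_measure_itv/= lte_fin; case: ltP => //.
  by move=> ba; congr EFin; lra.
rewrite EFinM -lab.
rewrite integral_cst//.
Qed.

(** The derivative of [f] need not be integrable, so the fundamental theorem of
    calculus is not available; this is the one-sided statement that survives.
    Slice [a, b] into the level sets of [h] of height [ep] and cover each slice
    by an open set of almost the same measure.  To the right of a point of slice
    [k], [f] grows at rate less than [k.+1 * ep], which is at most the rate of
    growth of the sum of [k.+1 * ep] times the measures of the open sets cut at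
    the current point.  Continuous induction compares the two, and the total of
    that sum exceeds the integral of [h] by at most [e]. *)
Lemma derive_le_integral (R : realType) (f df h : R -> R) (a b : R) :
  a <= b -> (forall t, a <= t <= b -> is_derive t 1 f (df t)) ->
  measurable_fun `[a, b] h -> (forall t, a <= t <= b -> 0 <= h t) ->
  (forall t, a <= t <= b -> df t <= h t) ->
  ((f b - f a)%:E <= \int[lebesgue_measure]_(t in `[a, b]) (h t)%:E)%E.
Proof.
move=> ab fdf mh h0 dfh.
have leM (A B : set R) : measurable A -> measurable B -> A `<=` B ->
    (lebesgue_measure A <= lebesgue_measure B)%E.
  by move=> mA mB AB; apply: le_measure; rewrite ?inE.
have leU (A B : set R) : measurable A -> measurable B ->
    (lebesgue_measure (A `|` B) <= lebesgue_measure A + lebesgue_measure B)%E.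
  by move=> mA mB; apply: measureU2.
apply/lee_addgt0Pr => e e0.
have ba1 : 0 < b - a + 1 by lra.
pose ep := e / (b - a + 1).
have ep0 : 0 < ep by rewrite divr_gt0.
pose E (k : nat) := `[a, b]%classic `&` h @^-1` [set` `[k%:R * ep, k.+1%:R * ep[].
have mE k : measurable (E k) by apply: mh => //; exact: measurable_itv.
have lab : lebesgue_measure `[a, b]%classic = (b - a)%:E.
  rewrite lebesgue_measure_itv/= lte_fin; case: ltP => //.
  by move=> ba; congr EFin; lra.
have lEk k : (lebesgue_measure (E k) < +oo)%E.
  apply: (@le_lt_trans _ _ (lebesgue_measure (`[a, b]%classic : set R))).
    by apply: leM => //; exact: subIsetl.
  by rewrite lab ltry.
pose ck (k : nat) : R := k.+1%:R * ep.
have ck0 k : 0 < ck k by rewrite mulr_gt0.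
have dk0 k : 0 < ep / (2 ^ k.+1)%:R / ck k.
  by rewrite divr_gt0// divr_gt0// ltr0n expn_gt0.
have /choice[U HU] k := lebesgue_regularity_outer (mE k) (lEk k) (dk0 k).
have oU k : open (U k) by case: (HU k).
have mU k : measurable (U k) by exact: open_measurable.
have EU k : E k `<=` U k by case: (HU k).
have mUE k : measurable (U k `\` E k) by exact: measurableD.
pose H y := (\sum_(0 <= k <oo) (ck k)%:E * lebesgue_measure (U k `&` `[a, y]))%E.
have H0 k (A : set R) : (0 <= (ck k)%:E * lebesgue_measure A)%E.
  by rewrite mule_ge0// lee_fin ltW.
apply: (@le_trans _ _ (H b)).
  apply: real_induction_le => //.
  - by move=> t /fdf; exact: is_derive_continuous.
  - move=> s t as_ st tb; apply: lee_nneseries => // k _.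
    apply: lee_wpmul2l; first by rewrite lee_fin ltW.
    apply: leM; [exact: measurableI|exact: measurableI|].
    by apply: setIS; apply: subset_itvl; rewrite bnd_simp.
  - by apply: nneseries_ge0.
  - move=> s /andP[as_ sb].
    have sab : a <= s <= b by rewrite as_ ltW.
    pose k := Num.truncn (h s / ep).
    have hs0 : 0 <= h s / ep by rewrite divr_ge0 ?h0// ltW.
    have Eks : E k s.
      split; rewrite /= in_itv/= ?sab//.
      have := truncn_itv hs0.
      by rewrite ler_pdivlMr// ltr_pdivrMr.
    have [d /= d0 dU] : exists2 d : R, 0 < d & forall y, `|s - y| < d -> U k y.
      have /nbhs_ballP[d d0 dU] : nbhs s (U k).
        by apply: open_nbhs_nbhs; split => //; exact: EU.
      by exists d.
    have g0 : 0 < ck k - df s.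
      rewrite subr_gt0 (le_lt_trans (dfh _ sab))//.
      by case: Eks => _ /=; rewrite in_itv/= => /andP[].
    have /nbhs_ballP[d' /= d'0 d'P] := is_derive_nbhs (fdf _ sab) g0.
    pose dd : R := Num.min (b - s) (Num.min d d' / 2).
    have m0 : 0 < Num.min d d' by rewrite lt_min d0.
    have dd0 : 0 < dd by rewrite lt_min subr_gt0 sb/= divr_gt0.
    have ddm : dd < Num.min d d'.
      by rewrite /dd gt_min; apply/orP; right; lra.
    have [ddd ddd'] : dd < d /\ dd < d' by move: ddm; rewrite lt_min => /andP.
    have ddb : dd <= b - s by rewrite /dd ge_min lexx.
    exists (s + dd); first by apply/andP; split; lra.
    have fle : f (s + dd) - f s <= ck k * dd.
      have : `|f (s + dd) - f s - df s * (s + dd - s)| <= (ck k - df s) * `|s + dd - s|.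
        by apply: d'P; rewrite /ball/= opprD addrA subrr add0r normrN gtr0_norm.
      rewrite (_ : s + dd - s = dd) ?(gtr0_norm dd0); last by lra. move=> /ler_normlW.
      by rewrite mulrBl lerBlDr subrK.
    have split_le : (\sum_(0 <= j <oo)
        ((ck j)%:E * lebesgue_measure (U j `&` `]s, (s + dd)%R]%classic) +
         (ck j)%:E * lebesgue_measure (U j `&` `[a, s]%classic)) <= H (s + dd)%R)%E.
      apply: lee_nneseries => [j _ _|j _]; first by rewrite adde_ge0.
      rewrite -ge0_muleDr//; apply: lee_wpmul2l; first by rewrite lee_fin ltW.
      have mU1 : measurable (U j `&` `]s, (s + dd)%R]%classic).
        by apply: measurableI => //; exact: measurable_itv.
      have mU2 : measurable (U j `&` `[a, s]%classic).
        by apply: measurableI => //; exact: measurable_itv.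
      rewrite -measureU//; last first.
        rewrite setIACA setIid (_ : _ `&` `[a, s]%classic = set0) ?setI0//.
        rewrite -subset0 => x []; rewrite /= !in_itv/= => /andP[sx _] /andP[_ xs].
        by move: sx; rewrite ltNge xs.
      apply: leM; [exact: measurableU|exact: measurableI|].
      rewrite -setIUr; apply: setIS => x /=; rewrite !in_itv/=.
      by move=> [/andP[? ?]|/andP[? ?]]; apply/andP; split; lra.
    apply: le_trans split_le; rewrite nneseriesD//; apply: leeD => //.
    have term_le : ((ck k)%:E * lebesgue_measure (U k `&` `]s, (s + dd)%R]%classic) <=
        \sum_(0 <= j <oo) (ck j)%:E * lebesgue_measure (U j `&` `]s, (s + dd)%R]%classic))%E.
      apply: le_trans (@nneseries_lim_ge _ _ xpredT 0%N k.+1 _) => //.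
      rewrite big_nat_recr//= leeDr//.
      by apply: sume_ge0.
    apply: le_trans term_le.
    rewrite setIidr; last first.
      move=> x /=; rewrite in_itv/= => /andP[sx xs]; apply: dU.
      by rewrite ltr_norml; apply/andP; split; lra.
    rewrite lebesgue_measure_itv/= lte_fin ltrDl dd0 -EFinB -EFinM lee_fin.
    by rewrite (_ : s + dd - s = dd)//; lra.
apply: (@le_trans _ _ (\sum_(0 <= k <oo)
    ((ck k)%:E * lebesgue_measure (E k) + (ep / (2 ^ k.+1)%:R)%:E))%E).
  apply: lee_nneseries => // k _.
  apply: (@le_trans _ _ ((ck k)%:E *
      (lebesgue_measure (E k) + lebesgue_measure (U k `\` E k)))%E).
    apply: lee_wpmul2l; first by rewrite lee_fin ltW.
    have mUb : measurable (U k `&` `[a, b]%classic).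
      by apply: measurableI => //; exact: measurable_itv.
    have mEUE : measurable (E k `|` (U k `\` E k)) by exact: measurableU.
    apply: le_trans (leU _ _ (mE k) (mUE k)); apply: leM => //.
    by move=> x [Ux _]; have [Ex|Ex] := pselect (E k x); [left|right].
  rewrite ge0_muleDr// leeD2l//.
  case: (HU k) => _ _ /ltW Hk.
  apply: (@le_trans _ _ ((ck k)%:E * (ep / (2 ^ k.+1)%:R / ck k)%:E)%E).
    by apply: lee_wpmul2l => //; rewrite lee_fin ltW.
  by rewrite -EFinM lee_fin mulrC divfK// gt_eqF.
apply: (le_trans (epsilon_trick _ _ _)) => //; first exact: ltW.
rewrite (_ : e = ep * (b - a) + ep); last first.
  by rewrite -[X in _ + X]mulr1 -mulrDr divfK// gt_eqF.
rewrite EFinD addeA leeD2r//.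
apply: (@le_trans _ _ (\sum_(0 <= k <oo)
    \int[lebesgue_measure]_(t in E k) ((h t)%:E + ep%:E))%E).
  apply: lee_nneseries => // k _.
  have -> : ((ck k)%:E * lebesgue_measure (E k) =
      \int[lebesgue_measure]_(t in E k) (ck k)%:E)%E.
    by rewrite integral_cst//; exact: mE.
  apply: ge0_le_integral => //; first exact: mE.
  - by move=> x _; rewrite lee_fin ltW.
  - apply: emeasurable_funD => //; apply/measurable_EFinP.
    by apply: measurable_funS mh => //; exact: subIsetl.
  - move=> x [_ /=]; rewrite in_itv/= => /andP[+ _].
    by rewrite -EFinD lee_fin /ck -natr1 mulrDl mul1r lerD2r.
have UE : \bigcup_k E k = `[a, b]%classic.
  apply/seteqP; split => [x [k _ []]//|x xab].
  have hx0 : 0 <= h x / ep by rewrite divr_ge0 ?h0// ?ltW//.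
  exists (Num.truncn (h x / ep)) => //; split => //=; rewrite in_itv/=.
  by have := truncn_itv hx0; rewrite ler_pdivlMr// ltr_pdivrMr.
rewrite -ge0_integral_bigcup//; last 3 first.
- rewrite UE; apply: emeasurable_funD => //; exact/measurable_EFinP.
- rewrite UE => x /=; rewrite in_itv/= => /h0 hx.
  by rewrite -EFinD lee_fin addr_ge0// ltW.
- apply/trivIsetP => i j _ _ ij; rewrite -subset0 => x [].
  move=> [_ /=]; rewrite in_itv/= => /andP[i1 i2] [_ /=]; rewrite in_itv/= => /andP[j1 j2].
  have : (i%:R : R) < j.+1%:R by rewrite -(ltr_pM2r ep0) (le_lt_trans i1).
  have : (j%:R : R) < i.+1%:R by rewrite -(ltr_pM2r ep0) (le_lt_trans j1).
  rewrite !ltr_nat !ltnS => ji ij'.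
  by move: ij; rewrite eqn_leq ij' ji.
have hI0 : forall x, `[a, b]%classic x -> (0 <= (h x)%:E)%E.
  by move=> x /=; rewrite in_itv/= => /h0; rewrite lee_fin.
have mhE : measurable_fun `[a, b] (EFin \o h) by exact/measurable_EFinP.
have e0' : forall x : R, `[a, b]%classic x -> (0 <= ep%:E)%E.
  by move=> x _; rewrite lee_fin ltW.
rewrite UE ge0_integralD//.
by rewrite integral_cst_itvcc.
Qed.

(** * Joint measurability and expected increments *)

Section joint_measurability.
Context {R : realType} {d : measure_display} {T : measurableType d}.

(** The process is the limit of its values at the times rounded down to the
    multiples of [1 / k.+1]; these approximations are constant in time on the
    cells of a countable partition. *)
Lemma measurable_joint_continuous (u : R -> T -> R) :
  (forall t, measurable_fun setT (u t)) -> (forall w, continuous (u ^~ w)) ->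
  measurable_fun setT (fun p : measurableTypeR R * T => u p.1 p.2).
Proof.
move=> mu cu.
pose g (k : nat) (t : R) : R := (Num.floor (k.+1%:R * t))%:~R / k.+1%:R.
apply: (@measurable_fun_cvg _ _ _ _ (fun k (p : measurableTypeR R * T) => u (g k p.1) p.2)).
- move=> k _ B mB; rewrite setTI.
  pose F (z : int) : set (measurableTypeR R * T) :=
    `[z%:~R / k.+1%:R, (z + 1)%:~R / k.+1%:R[%classic `*` (u (z%:~R / k.+1%:R) @^-1` B).
  rewrite (_ : _ @^-1` _ = \bigcup_z F z).
    apply: countable_bigcupT_measurable => [|z]; first exact: countableP.
    apply: measurableX; first exact: measurable_itv.
    by rewrite -[X in measurable X]setTI; exact: mu.
  have k0 : 0 < k.+1%:R :> R by [].
  apply/seteqP; split => [[t w] /= Bu|[t w] /= [z _ [/= tz uz]]].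
    exists (Num.floor (k.+1%:R * t)) => //; split => //=.
    rewrite in_itv/= ler_pdivrMr// ltr_pdivlMr// ![t * _]mulrC.
    by rewrite floor_le floorD1_gt.
  rewrite /g (_ : Num.floor _ = z)//.
  apply/eqP; rewrite floor_eq//.
  by move: tz; rewrite in_itv/= ler_pdivrMr// ltr_pdivlMr// ![t * _]mulrC.
- move=> [t w] _ /=; apply: (cvg_comp (g^~ t) (u^~ w)) (cu w t).
  apply/cvgrPdist_le => e e0; near=> k.
  have k0 : 0 < k.+1%:R :> R by [].
  rewrite (_ : t - g k t = (k.+1%:R * t - (Num.floor (k.+1%:R * t))%:~R) / k.+1%:R); last first.
    by rewrite /g [RHS]mulrBl [X in X / _ - _]mulrC mulfK// gt_eqF.
  have f1 := floor_le (k.+1%:R * t); have f2 := floorD1_gt (k.+1%:R * t).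
  rewrite ger0_norm ?divr_ge0 ?subr_ge0//.
  apply: (@le_trans _ _ k.+1%:R^-1); last first.
    by apply/ltW; near: k; exact: (near_infty_natSinv_lt (PosNum e0)).
  by rewrite -[leRHS]mul1r ler_pM2r ?invr_gt0// lerBlDl ltW// -intrD1.
Unshelve. all: end_near. Qed.

Lemma measurable_joint_derive (u v : R -> T -> R) :
  (forall t, measurable_fun setT (u t)) ->
  (forall (t : R) w, is_derive t 1 (u ^~ w) (v t w)) ->
  measurable_fun setT (fun p : measurableTypeR R * T => v p.1 p.2).
Proof.
move=> mu duv.
have cu w : continuous (u ^~ w) by move=> t; exact: is_derive_continuous (duv t w).
apply: (@measurable_fun_cvg _ _ _ _ (fun k (p : measurableTypeR R * T) =>
  k.+1%:R * (u (k.+1%:R^-1 + p.1) p.2 - u p.1 p.2))).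
- move=> k; apply: measurable_funM => //; apply: measurable_funB.
    apply: (measurable_joint_continuous (u := fun t => u (k.+1%:R^-1 + t))) => // w t.
    apply: (cvg_comp (fun t => k.+1%:R^-1 + t) (u^~ w)) (cu w _).
    by apply: cvgD; [exact: cvg_cst|exact: cvg_id].
  exact: measurable_joint_continuous.
- move=> [t w] _ /=; have [+ <-] := duv t w.
  rewrite /derivable => /cvgP; rewrite /derive => H.
  have H2 : (fun k : nat => k.+1%:R^-1 : R) @ \oo --> (0 : R)^'.
    move=> A [e /= e0 eA]; change (\forall k \near \oo, A (k.+1%:R^-1)).
    near=> k; apply: eA => /=.
      rewrite sub0r normrN ger0_norm//; near: k.
      exact: (near_infty_natSinv_lt (PosNum e0)).
    by rewrite gt_eqF// invr_gt0.
  have := cvg_comp _ _ H2 H; apply: cvg_trans.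
  apply: near_eq_cvg; near=> k => /=.
  by rewrite invrK /= /GRing.scale/= mulr1.
Unshelve. all: end_near. Qed.

End joint_measurability.

Section expectation.
Context {R : realType} {d : measure_display} {T : measurableType d}.
Variable P : probability T R.

(** Integrate the pathwise bound of [derive_le_integral] and exchange the two
    integrals, which only involves the nonnegative function [h]. *)
Lemma integral_increment_le (u du h : R -> T -> R) (a b kappa : R) :
  a <= b ->
  (forall w (t : R), a <= t <= b -> is_derive t 1 (u ^~ w) (du t w)) ->
  measurable_fun setT (fun p : measurableTypeR R * T => h p.1 p.2) ->
  (forall t w, 0 <= h t w) ->
  (forall t w, a <= t <= b -> du t w <= h t w) ->
  (forall t, a <= t <= b -> (\int[P]_w (h t w)%:E <= kappa%:E)%E) ->
  P.-integrable setT (fun w => (u b w - u a w)%:E) ->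
  (\int[P]_w (u b w - u a w)%:E <= (kappa * (b - a))%:E)%E.
Proof.
move=> ab duP mh h0 duh hk iu.
pose F (p : measurableTypeR R * T) : \bar R :=
  (h p.1 p.2 * \1_(`[a, b]%classic : set R) p.1)%:E.
have mF : measurable_fun setT F.
  apply/measurable_EFinP; apply: measurable_funM => //.
  have m1 : measurable_fun setT (\1_(`[a, b]%classic : set R) : measurableTypeR R -> R).
    by apply: measurable_indic; exact: measurable_itv.
  exact: (measurableT_comp m1 measurable_fst).
have F0 p : (0 <= F p)%E by rewrite lee_fin mulr_ge0.
have Fab (f : R -> R) : (\int[lebesgue_measure]_(t in `[a, b]) (f t)%:E =
    \int[lebesgue_measure]_t (f t * \1_(`[a, b]%classic : set R) t)%:E)%E.
  rewrite integral_mkcond; apply: eq_integral => t _; rewrite patchE indicE.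
  by case: ifPn; rewrite ?mulr1 ?mulr0.
pose psi w := (\int[lebesgue_measure]_(t in `[a, b]) (h t w)%:E)%E.
have psiE : psi =
    fubini_G (lebesgue_measure : {sigma_finite_measure set (measurableTypeR R) -> \bar R}) F.
  by apply/funext => w; rewrite /psi Fab.
have mpsi : measurable_fun setT psi by rewrite psiE; exact: measurable_fun_fubini_tonelli_G.
have psi0 w : (0 <= psi w)%E by apply: integral_ge0 => t _; rewrite lee_fin.
have mht t : measurable_fun setT (h t).
  exact: (measurableT_comp mh (measurable_pair1 t)).
have Ipsi : (\int[P]_w psi w <= (kappa * (b - a))%:E)%E.
  rewrite psiE /fubini_G -fubini_tonelli//.
  have -> : (\int[lebesgue_measure]_x \int[P]_y F (x, y) =
      \int[lebesgue_measure]_(t in `[a, b]) \int[P]_w (h t w)%:E)%E.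
    rewrite [RHS]integral_mkcond; apply: eq_integral => t _.
    rewrite patchE /F/= indicE; case: ifPn => _.
      by under eq_integral do rewrite mulr1.
    under eq_integral do rewrite mulr0.
    exact: integral0.
  have mI : measurable_fun `[a, b] (fun t : R => (\int[P]_w (h t w)%:E)%E).
    apply: (@measurable_funTS _ _ (measurableTypeR R)).
    apply: (@measurable_fun_fubini_tonelli_F _ _ (measurableTypeR R) _ _ P
      (fun p => (h p.1 p.2)%:E)).
      exact/measurable_EFinP.
    by move=> p; rewrite lee_fin.
  have hk' : forall t : R, `[a, b]%classic t -> (\int[P]_w (h t w)%:E <= kappa%:E)%E.
    by move=> t /=; rewrite in_itv/= => /hk.
  have k0 : (0 <= kappa%:E)%E.
    apply: le_trans (hk a _); first by apply: integral_ge0 => w _; rewrite lee_fin.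
    by rewrite lexx.
  apply: (@le_trans _ _ (\int[lebesgue_measure]_(t in `[a, b]) kappa%:E)%E).
    apply: ge0_le_integral => //.
    by move=> t _; apply: integral_ge0 => w _; rewrite lee_fin.
  by rewrite integral_cst_itvcc.
have ipsi : P.-integrable setT psi.
  apply/integrableP; split => //.
  under eq_integral do rewrite gee0_abs//.
  by apply: le_lt_trans Ipsi _; rewrite ltry.
apply: le_trans Ipsi; apply: le_integral => //.
move=> w _; apply: (derive_le_integral (f := u^~ w) (df := du^~ w)) => //.
- apply: (@measurable_funTS _ _ (measurableTypeR R)).
  exact: (measurableT_comp mh (measurable_pair2 w)).
- by move=> t; exact: duh.
Qed.

End expectation.

(** * A category argument for local boundedness *)

Section local_boundedness.
Context {R : realType}.
Implicit Types G : R -> R.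

(** With explicit radii, so that reflecting time is a one-line matter. *)
Definition bounded_near G (t : R) : Prop :=
  exists K e, 0 < e /\ forall s, `|s - t| < e -> G s <= K.

Let bounded_near_opp G t : bounded_near (G \o -%R) (- t) <-> bounded_near G t.
Proof.
split=> -[K [e [e0 GK]]]; exists K, e; split => // s st.
  rewrite -[s]opprK; apply: GK.
  by rewrite (_ : _ - _ = - (s - t)) ?normrN//; lra.
by apply: GK; rewrite (_ : _ - _ = - (s - - t)) ?normrN//; lra.
Qed.

Let bounded_near_open G t : bounded_near G t ->
  exists2 e : R, 0 < e & forall s, `|s - t| < e -> bounded_near G s.
Proof.
move=> [K [e [e0 GK]]]; exists e => // s st; exists K, (e - `|s - t|).
split; first by rewrite subr_gt0.
move=> r rs; apply: GK; rewrite (_ : r - t = (r - s) + (s - t)); last by lra.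
by rewrite (le_lt_trans (ler_normD _ _))//; lra.
Qed.

Let last_bad_point G (t r : R) :
  (forall s r, s < r -> (forall x, s < x < r -> bounded_near G x) -> G s = G r) ->
  ~ bounded_near G t -> bounded_near G r -> t < r ->
  exists s, [/\ t <= s < r, ~ bounded_near G s & G s = G r].
Proof.
move=> HG bt br tr.
pose S := [set x | t <= x <= r /\ ~ bounded_near G x].
have St : S t by split; rewrite ?lexx ?(ltW tr).
have supS : has_sup S by split; [exists t|exists r => x [/andP[]]].
have tS : t <= sup S by apply: ub_le_sup => //; exact: (proj2 supS).
have Sr : sup S <= r by apply: ge_sup => [|x [/andP[]]//]; exists t.
have bs : ~ bounded_near G (sup S).
  move=> /bounded_near_open[e e0 He].
  have [x Sx xe] := sup_adherent e0 supS.
  have xs : x <= sup S by apply: ub_le_sup => //; exact: (proj2 supS).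
  by case: Sx => _; apply; apply: He; rewrite ler0_norm; lra.
have sr : sup S < r.
  by rewrite lt_neqAle Sr andbT; apply/eqP => srE; apply: bs; rewrite srE.
exists (sup S); split; rewrite ?tS//.
apply: HG => // x /andP[sx xr]; apply: contrapT => bx.
suff : x <= sup S by rewrite leNgt sx.
apply: ub_le_sup; first exact: (proj2 supS).
by split => //; lra.
Qed.

(** Let [B] be the closed set of points near which [G] is unbounded.  If [G] is
    at most [K] on the points of [B] near some [t] in [B], it is at most [K]
    near [t]: any other point lies in a gap of [B] and [G] takes there the value
    that it has at the end of the gap towards [t].  Hence every neighbourhood of
    a point of [B] contains points of [B] where [G] is arbitrarily large.  Lower
    semicontinuity turns them into nested intervals on which [G] exceeds [k],
    for every [k], and their common point is a contradiction. *)
Lemma lsc_bounded_near G :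
  (forall t K, K < G t -> exists2 e : R, 0 < e & forall s, `|s - t| < e -> K < G s) ->
  (forall s t, s < t -> (forall r, s < r < t -> bounded_near G r) -> G s = G t) ->
  forall t, bounded_near G t.
Proof.
move=> lscG gapG t0; apply: contrapT => bt0.
have large t e K : ~ bounded_near G t -> 0 < e ->
    exists s, [/\ ~ bounded_near G s, `|s - t| < e & K < G s].
  move=> bt e0; apply: contrapT => noS.
  have GK s : ~ bounded_near G s -> `|s - t| < e -> G s <= K.
    by move=> bs st; rewrite leNgt; apply/negP => Ks; apply: noS; exists s.
  have bt' := bt; apply: bt; exists K, e; split => // r rt.
  have [br|br] := pselect (bounded_near G r); last exact: GK.
  have [tr|rt'|rt'] := ltgtP t r; last first.
  - by apply: GK => //; move: bt'; rewrite rt'.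
  - have Gr' s r' : s < r' -> (forall x, s < x < r' -> bounded_near (G \o -%R) x) ->
        (G \o -%R) s = (G \o -%R) r'.
      move=> sr H; apply/esym/gapG; first by rewrite ltrN2.
      move=> x xs; rewrite -bounded_near_opp; apply: H; lra.
    have [|||s [/andP[ts sr] bs Grs]] := @last_bad_point (G \o -%R) (- t) (- r) Gr'.
    + by rewrite bounded_near_opp.
    + exact/bounded_near_opp.
    + by rewrite ltrN2.
    move: Grs; rewrite /= opprK => <-; apply: GK.
      by rewrite -bounded_near_opp opprK.
    by move: rt; rewrite !ler0_norm; lra.
  - have [|s [/andP[ts sr] bs Grs]] := last_bad_point gapG _ br tr; first exact: bt'.
    rewrite -Grs; apply: GK bs _.
    by move: rt; rewrite !ger0_norm; lra.
pose state := {p : R * R | ~ bounded_near G p.1 /\ 0 < p.2}.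
(* Halving the radius leaves room for the strict inequality at the endpoints. *)
have step (q : nat * state) : exists p : state,
    `|(sval p).1 - (sval q.2).1| + (sval p).2 <= (sval q.2).2 /\
    forall s, `|s - (sval p).1| <= (sval p).2 -> q.1%:R < G s.
  case: q => k [[t e] /= [bt e0]].
  have [s [bs st Ks]] := large t e k%:R bt e0.
  have [e' e'0 He'] := lscG _ _ Ks.
  pose e'' := Num.min e' (e - `|s - t|) / 2.
  have m0 : 0 < Num.min e' (e - `|s - t|) by rewrite lt_min e'0 subr_gt0.
  have m1 : Num.min e' (e - `|s - t|) <= e' by rewrite ge_min lexx.
  have m2 : Num.min e' (e - `|s - t|) <= e - `|s - t| by rewrite ge_min lexx orbT.
  have e''0 : 0 < e'' by rewrite divr_gt0.
  exists (exist _ (s, e'') (conj bs e''0)) => /=; split; first by rewrite /e''; lra.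
  by move=> x xs; apply: He'; rewrite (le_lt_trans xs)// /e''; lra.
have [f Hf] := choice step.
pose p (k : nat) :=
  nat_rect (fun=> state) (exist _ (t0, 1) (conj bt0 ltr01)) (fun k q => f (k, q)) k.
pose c k := (sval (p k)).1; pose r k := (sval (p k)).2.
have r0 k : 0 < r k by rewrite /r; case: (p k) => -[? ?] [].
have nest k : c k - r k <= c k.+1 - r k.+1 /\ c k.+1 + r k.+1 <= c k + r k.
  have [+ _] := Hf (k, p k); rewrite -/(p k.+1) /= -!/(c _) -!/(r _) => H.
  have := ler_norm (c k.+1 - c k); have := ler_norm (- (c k.+1 - c k)).
  by rewrite normrN; lra.
have mono : {homo (fun k => c k - r k) : m n / (m <= n)%N >-> m <= n}.
  by apply: homo_leq => [//|x y z|k]; [exact: le_trans|case: (nest k)].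
have anti m n : (m <= n)%N -> c n + r n <= c m + r m.
  elim: n => [|n IH]; first by rewrite leqn0 => /eqP ->.
  rewrite leq_eqVlt => /orP[/eqP ->//|/ltnSE/IH].
  by apply: le_trans; case: (nest n).
have lr m n : c m - r m <= c n + r n.
  have := r0 m; have := r0 n.
  have [mn|/ltnW mn] := leqP m n.
    by have := mono _ _ mn; lra.
  by have := anti _ _ mn; lra.
pose A := range (fun k => c k - r k).
have supA : has_sup A.
  split; first by exists (c 0%N - r 0%N), 0%N.
  by exists (c 0%N + r 0%N) => _ [k _ <-]; exact: lr.
have xl k : c k - r k <= sup A.
  by apply: ub_le_sup; [exact: (proj2 supA)|exists k].
have xr k : sup A <= c k + r k.
  by apply: ge_sup => [|_ [j _ <-]]; [exact: (proj1 supA)|exact: lr].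
have Gx (k : nat) : k%:R < G (sup A).
  have [_ H] := Hf (k, p k); apply: H; rewrite -/(p k.+1) -/(c _) -/(r _).
  by rewrite ler_norml; have := xl k.+1; have := xr k.+1; lra.
have := Gx (Num.truncn (G (sup A))).+1.
rewrite ltNge ltW//; exact: truncnS_gt.
Qed.

End local_boundedness.

(** * Expectations of real random variables *)

Section real_expectation.
Context {R : realType} {d : measure_display} {T : measurableType d}.
Variable P : probability T R.
Implicit Types f g h : T -> R.

Definition integrable1 f : Prop := P.-integrable setT (EFin \o f).

Definition integrable2 f : Prop :=
  measurable_fun setT f /\ integrable1 (fun w => f w ^+ 2).

Lemma integrable1_measurable f : integrable1 f -> measurable_fun setT f.
Proof. by move=> /measurable_int/measurable_EFinP. Qed.

Lemma EFin_Rintegral f : integrable1 f ->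
  (\int[P]_w (f w)%:E)%E = (\int[P]_w f w)%:E.
Proof. by move=> sf; rewrite fineK//; exact: integrable_fin_num. Qed.

Lemma integrable1_ge0 f : measurable_fun setT f -> (forall w, 0 <= f w) ->
  (\int[P]_w (f w)%:E < +oo)%E -> integrable1 f.
Proof.
move=> mf f0 foo; apply/integrableP; split; first exact/measurable_EFinP.
by under eq_integral do rewrite gee0_abs ?lee_fin//.
Qed.

Lemma le_integrable1 f g : measurable_fun setT f -> integrable1 g ->
  (forall w, `|f w| <= g w) -> integrable1 f.
Proof.
move=> mf sg fg; apply: (le_integrable _ _ _ sg) => //; first exact/measurable_EFinP.
by move=> w _ /=; rewrite lee_fin (le_trans (fg w))// ler_norm.
Qed.

Lemma integrable1_cst (k : R) : integrable1 (fun=> k).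
Proof. exact: finite_measure_integrable_cst. Qed.

Lemma Rexpectation_cst (k : R) : \int[P]_w k = k.
Proof. by rewrite /Rintegral integral_cst//= probability_setT mule1. Qed.

Lemma integrable1D f g : integrable1 f -> integrable1 g -> integrable1 (fun w => f w + g w).
Proof. by move=> sf sg; exact: (integrableD _ sf sg). Qed.

Lemma integrable1Z (k : R) f : integrable1 f -> integrable1 (fun w => k * f w).
Proof. by move=> sf; exact: (integrableZl _ k sf). Qed.

Lemma integrable1N f : integrable1 f -> integrable1 (fun w => - f w).
Proof. by move=> sf; under eq_fun do rewrite -mulN1r; exact: integrable1Z. Qed.

Lemma integrable1B f g : integrable1 f -> integrable1 g -> integrable1 (fun w => f w - g w).
Proof. by move=> sf sg; apply: integrable1D => //; exact: integrable1N. Qed.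

Lemma integrable1_sum (I : Type) (s : seq I) (f : I -> T -> R) :
  (forall i, integrable1 (f i)) -> integrable1 (fun w => \sum_(i <- s) f i w).
Proof.
move=> sf; elim: s => [|i s IH].
  by under eq_fun do rewrite big_nil; exact: integrable1_cst.
by under eq_fun do rewrite big_cons; exact: integrable1D.
Qed.

Lemma Rexpectation_sum (I : Type) (s : seq I) (f : I -> T -> R) :
  (forall i, integrable1 (f i)) ->
  \int[P]_w (\sum_(i <- s) f i w) = \sum_(i <- s) \int[P]_w f i w.
Proof.
move=> sf; elim: s => [|i s IH].
  by under eq_Rintegral do rewrite big_nil; rewrite big_nil Rexpectation_cst.
under eq_Rintegral do rewrite big_cons.
by rewrite RintegralD//; [rewrite IH big_cons|exact: sf|exact: integrable1_sum].
Qed.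

Lemma le_Rexpectation f g : integrable1 f -> integrable1 g ->
  (forall w, f w <= g w) -> \int[P]_w f w <= \int[P]_w g w.
Proof. by move=> sf sg fg; apply: le_Rintegral. Qed.

Lemma integrable2M f g : integrable2 f -> integrable2 g -> integrable1 (fun w => f w * g w).
Proof.
move=> [mf sf] [mg sg]; apply: (le_integrable1 _ (integrable1D sf sg)).
  exact: measurable_funM.
move=> w; rewrite ler_norml; nra.
Qed.

Lemma le_integrable2 f g : measurable_fun setT f -> integrable2 g ->
  (forall w, `|f w| <= `|g w|) -> integrable2 f.
Proof.
move=> mf [mg sg] fg; split => //.
apply: (le_integrable1 _ sg) => [|w]; first exact: measurable_funX.
by rewrite normrX -(real_normK (num_real (g w))) lerXn2r ?nnegrE.
Qed.

Lemma integrable2Z (k : R) f : integrable2 f -> integrable2 (fun w => k * f w).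
Proof.
move=> [mf sf]; split; first exact: measurable_funM.
by under eq_fun do rewrite exprMn; exact: integrable1Z.
Qed.

Lemma integrable2D f g : integrable2 f -> integrable2 g -> integrable2 (fun w => f w + g w).
Proof.
move=> sf sg; split.
  by apply: measurable_funD; [case: sf|case: sg].
under eq_fun do rewrite sqrrD -mulr_natl.
apply: integrable1D; last by case: sg.
apply: integrable1D; first by case: sf.
by apply: integrable1Z; exact: integrable2M.
Qed.

Lemma integrable2N f : integrable2 f -> integrable2 (fun w => - f w).
Proof. by move=> sf; under eq_fun do rewrite -mulN1r; exact: integrable2Z. Qed.

Lemma integrable2B f g : integrable2 f -> integrable2 g -> integrable2 (fun w => f w - g w).
Proof. by move=> sf sg; apply: integrable2D => //; exact: integrable2N. Qed.

Lemma integrable2_cst (k : R) : integrable2 (fun=> k).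
Proof. by split => //; exact: integrable1_cst. Qed.

Lemma integrable2W f : integrable2 f -> integrable1 f.
Proof.
by move=> /integrable2M/(_ (integrable2_cst 1)); under eq_fun do rewrite mulr1.
Qed.

Lemma integrable2_bounded (k : R) f : measurable_fun setT f ->
  (forall w, `|f w| <= k) -> integrable2 f.
Proof.
move=> mf fk; apply: (le_integrable2 mf (integrable2_cst k)) => w.
by rewrite (le_trans (fk w))// ler_norm.
Qed.

Lemma Rexpectation_fatou (f : nat -> T -> R) g (K : R) :
  (forall k, integrable1 (f k)) -> (forall k w, 0 <= f k w) ->
  (forall w, f k w @[k --> \oo] --> g w) ->
  (forall k, \int[P]_w f k w <= K) ->
  integrable1 g /\ \int[P]_w g w <= K.
Proof.
move=> sf f0 fg fK.
have mg : measurable_fun setT g.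
  by apply: (@measurable_fun_cvg _ _ _ _ f) => // k; exact: integrable1_measurable.
have g0 w : 0 <= g w.
  rewrite -(cvg_lim _ (fg w))//; apply: limr_ge.
    by apply/cvg_ex; exists (g w); exact: fg.
  by apply: nearW => k; exact: f0.
have gK : (\int[P]_w (g w)%:E <= K%:E)%E.
  have := @fatou _ _ _ P setT measurableT (fun k => EFin \o f k) _ _.
  have -> : (\int[P]_w limn_einf ((fun k => EFin \o f k)^~ w) = \int[P]_w (g w)%:E)%E.
    apply: eq_integral => w _.
    have fgE : (EFin \o f k) w @[k --> \oo] --> (g w)%:E.
      by apply: cvg_EFin => //; [exact: nearW|exact: fg].
    by rewrite is_cvg_limn_einfE; [apply/cvg_lim|apply/cvg_ex; exists (g w)%:E].
  move=> H; apply: le_trans (H _ _) _ => //.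
  - by move=> k; apply/measurable_EFinP; exact: integrable1_measurable.
  - by move=> k w _; rewrite lee_fin.
  rewrite limn_einf_lim; apply: lime_le; first exact: is_cvg_einfs.
  apply: nearW => k; apply: (@le_trans _ _ (\int[P]_w (f k w)%:E)%E).
    by apply: ereal_inf_lbound; exists k => /=.
  by rewrite EFin_Rintegral// lee_fin.
have sg : integrable1 g by apply: integrable1_ge0 => //; rewrite (le_lt_trans gK) ?ltry.
by split => //; move: gK; rewrite EFin_Rintegral// lee_fin.
Qed.

Lemma Rexpectation_dominated (f : nat -> T -> R) g h :
  (forall k, measurable_fun setT (f k)) ->
  (forall w, f k w @[k --> \oo] --> g w) ->
  integrable1 h -> (forall k w, `|f k w| <= h w) ->
  integrable1 g /\ \int[P]_w f k w @[k --> \oo] --> \int[P]_w g w.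
Proof.
move=> mf fg sh fh.
have mg : measurable_fun setT g by exact: (@measurable_fun_cvg _ _ _ _ f).
have [] := @dominated_convergence _ _ _ P setT measurableT
  (fun k => EFin \o f k) (EFin \o g) (EFin \o h).
- by move=> k; exact/measurable_EFinP.
- exact/measurable_EFinP.
- by apply: aeW => w _; apply: cvg_EFin; [exact: nearW|exact: fg].
- exact: sh.
- by apply: aeW => w k _ /=; rewrite lee_fin.
move=> sg _ cv; split => //.
apply: fine_cvg.
by move: cv; rewrite /= (EFin_Rintegral sg).
Qed.

Lemma Rexpectation_increment_le (u du h : R -> T -> R) (a b kappa : R) :
  a <= b ->
  (forall w (t : R), a <= t <= b -> is_derive t 1 (u ^~ w) (du t w)) ->
  measurable_fun setT (fun p : measurableTypeR R * T => h p.1 p.2) ->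
  (forall t w, 0 <= h t w) ->
  (forall t w, a <= t <= b -> du t w <= h t w) ->
  (forall t, a <= t <= b -> integrable1 (h t) /\ \int[P]_w h t w <= kappa) ->
  integrable1 (u a) -> integrable1 (u b) ->
  \int[P]_w u b w - \int[P]_w u a w <= kappa * (b - a).
Proof.
move=> ab du_ mh h0 duh hk sa sb.
have sab := integrable1B sb sa.
rewrite -RintegralB// -lee_fin -EFin_Rintegral//.
apply: (integral_increment_le ab du_ mh) => // t /hk[st].
by rewrite EFin_Rintegral// lee_fin.
Qed.

End real_expectation.

(** * One random process that is differentiable at every time *)

(** A bounded smooth truncation of the square with bounded derivative; it
    increases to the square as [e] decreases to 0. *)
Definition satsq (R : realType) (e x : R) : R := x ^+ 2 / (1 + e * x ^+ 2).

Definition dsatsq (R : realType) (e x : R) : R := 2 * x / (1 + e * x ^+ 2) ^+ 2.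

Section satsq.
Context {R : realType} (e : R).
Hypothesis e01 : 0 < e <= 1.

Let den_gt0 (x : R) : 0 < 1 + e * x ^+ 2.
Proof. by rewrite ltr_pwDl// mulr_ge0 ?sqr_ge0//; case/andP : e01 => /ltW. Qed.

Lemma satsq_ge0 x : 0 <= satsq e x.
Proof. by rewrite divr_ge0 ?sqr_ge0// ltW. Qed.

Lemma satsq_le x : satsq e x <= e^-1.
Proof.
case/andP: e01 => e0 _; rewrite ler_pdivrMr// mulrDr mulr1 mulKf ?gt_eqF//.
by rewrite lerDr invr_ge0 ltW.
Qed.

Lemma satsq_le_sq x : satsq e x <= x ^+ 2.
Proof.
case/andP: e01 => /ltW e0 _; rewrite ler_pdivrMr// ler_peMr ?sqr_ge0//.
by rewrite lerDl mulr_ge0// sqr_ge0.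
Qed.

Lemma dsatsq_le x : `|dsatsq e x| <= e^-1.
Proof.
case/andP: e01 => e0 e1.
rewrite normrM normfV normrX (gtr0_norm (den_gt0 x)) ler_pdivrMr ?exprn_gt0//.
rewrite -[X in _ <= _ * X]/((1 + e * x ^+ 2) * (1 + e * x ^+ 2)) mulrA.
apply: (@le_trans _ _ (1 + x ^+ 2)).
  have := sqr_ge0 (1 - x); have := sqr_ge0 (1 + x).
  by rewrite ler_norml; move=> ? ?; apply/andP; split; nra.
apply: (@le_trans _ _ (e^-1 * (1 + e * x ^+ 2))).
  by rewrite mulrDr mulr1 mulKf ?gt_eqF// lerD2r invf_ge1.
rewrite ler_peMr ?lerDl//.
  by rewrite mulr_ge0 ?invr_ge0 ?ltW.
by rewrite mulr_ge0 ?sqr_ge0// ltW.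
Qed.

Lemma is_derive_satsq x : is_derive x (1 : R) (satsq e) (dsatsq e x).
Proof.
have d0 := den_gt0 x.
have H : is_derive x (1 : R)
    ((@GRing.exp R ^~ 2) * (fun y => (1 + e * y ^+ 2)^-1)) (dsatsq e x).
  have Hi : is_derive x (1 : R) (fun y => (1 + e * y ^+ 2)^-1)
      (- (1 + e * x ^+ 2) ^- 2 *: (e * (2 * x))).
    apply: is_deriveV; first by rewrite gt_eqF.
    apply: is_derive_eq.
    by rewrite /GRing.scale/=; ring.
  apply: is_derive_eq.
  rewrite /dsatsq /GRing.scale/=; field.
  by rewrite gt_eqF.
by [].
Qed.

Lemma continuous_satsq : continuous (satsq e).
Proof.
by move=> x; exact: is_derive_continuous (is_derive_satsq x).
Qed.

Lemma measurable_satsq : measurable_fun setT (satsq e).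
Proof. exact: continuous_measurable_fun continuous_satsq. Qed.

Lemma measurable_dsatsq : measurable_fun setT (dsatsq e).
Proof.
apply: continuous_measurable_fun => x.
have cden : (1 + e * y ^+ 2) @[y --> x] --> 1 + e * x ^+ 2.
  apply: cvgD; first exact: cvg_cst.
  by apply: cvgM; [exact: cvg_cst|exact: exprn_continuous].
apply: cvgM.
  by apply: cvgM; [exact: cvg_cst|exact: cvg_id].
apply: cvgV; first by rewrite expf_neq0// gt_eqF.
exact: (cvgM cden cden).
Qed.

End satsq.

Section single_process.
Context {R : realType} {d : measure_display} {T : measurableType d}.
Variables (P : probability T R) (x v : R -> T -> R).
Hypothesis mx : forall t, measurable_fun setT (x t).
Hypothesis dx : forall w (t : R), is_derive t 1 (x ^~ w) (v t w).

Let mxJ : measurable_fun setT (fun p : measurableTypeR R * T => x p.1 p.2).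
Proof.
apply: measurable_joint_continuous => // w t.
exact: is_derive_continuous (dx w t).
Qed.

Let mvJ : measurable_fun setT (fun p : measurableTypeR R * T => v p.1 p.2).
Proof. exact: (measurable_joint_derive mx). Qed.

(** Integrating [|v|] and squaring would need the Cauchy-Schwarz inequality in
    time.  Weighting the squared displacement by the decreasing factor
    [2 * b - a - t] gives it for free: the derivative of the product is
    [2 y v q - y^2], which is at most [q^2 v^2]. *)
Lemma displacement_sq_le (a b K : R) : a <= b ->
  (forall t, a <= t <= b -> integrable2 P (v t) /\ \int[P]_w v t w ^+ 2 <= K) ->
  integrable2 P (x a) -> integrable2 P (x b) ->
  \int[P]_w (x b w - x a w) ^+ 2 <= 4 * K * (b - a) ^+ 2.
Proof.
rewrite le_eqVlt => /predU1P[<- _ _ _|ab vK sa sb].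
  under eq_Rintegral do rewrite subrr expr0n/=.
  by rewrite Rexpectation_cst subrr expr0n/= mulr0.
have ba0 : 0 < b - a by rewrite subr_gt0.
pose u t w := (x t w - x a w) ^+ 2 * (2 * b - a - t).
pose du t w := 2 * (x t w - x a w) * v t w * (2 * b - a - t) - (x t w - x a w) ^+ 2.
pose h t w := 4 * (b - a) ^+ 2 * v t w ^+ 2.
have s1 := integrable2B sb sa.
have := @Rexpectation_increment_le _ _ _ P u du h a b (4 * (b - a) ^+ 2 * K) (ltW ab).
have -> : \int[P]_w u b w = (b - a) * \int[P]_w (x b w - x a w) ^+ 2.
  rewrite -RintegralZl//; last by case: s1.
  by apply: eq_Rintegral => w _; rewrite /u; ring.
have u0 : u a = fun=> 0 by apply/funext => w; rewrite /u subrr expr0n/= mul0r.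
rewrite u0 Rexpectation_cst subr0 => H.
rewrite -(ler_pM2l ba0); apply: le_trans (H _ _ _ _ _ _ _) _.
- move=> w t _; rewrite /u /du; have dxt := dx w t.
  have : is_derive t (1 : R) ((x^~ w - cst (x a w)) ^+ 2 * (cst (2 * b - a) - id)) (du t w).
    apply: is_derive_eq.
    by rewrite !fctE /du /GRing.scale/=; ring.
  by [].
- apply: measurable_funM => //; exact: measurable_funX.
- by move=> t w; rewrite mulr_ge0 ?sqr_ge0// mulr_ge0 ?sqr_ge0.
- move=> t w /andP[at_ tb]; rewrite /du /h.
  set y := x t w - x a w; set z := v t w; set q := 2 * b - a - t.
  have q0 : 0 <= q by rewrite /q; lra.
  have q2 : q <= 2 * (b - a) by rewrite /q; lra.
  have := sqr_ge0 (q * z - y).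
  have qq : q ^+ 2 <= 4 * (b - a) ^+ 2 by nra.
  have : q ^+ 2 * z ^+ 2 <= 4 * (b - a) ^+ 2 * z ^+ 2 by rewrite ler_wpM2r// sqr_ge0.
  by nra.
- move=> t /vK[[mv sv] Kv]; split; first exact: integrable1Z.
  by rewrite RintegralZl// ler_wpM2l// mulr_ge0// sqr_ge0.
- exact: integrable1_cst.
- rewrite /u; under eq_fun do rewrite mulrC.
  by apply: integrable1Z; case: s1.
- rewrite le_eqVlt; apply/orP; left; apply/eqP; ring.
Qed.

(** The derivative [w] of the truncation along the path has expectation 0 and a
    bounded second moment.  As [h] must be nonnegative in the comparison, the
    drift [M * t] is added and [w + M] is bounded by
    [(w + 2 M)^2 / (4 M) = M + w + w^2 / (4 M)], whose expectation exceeds [M]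
    by at most [K' / (4 M)].  Letting [M] grow, the excess disappears.  The sign
    [s] allows the same argument to run on the opposite function. *)
Lemma satsq_expectation_le (a b K e s : R) : 0 < e <= 1 -> `|s| = 1 ->
  a <= b ->
  (forall t, a <= t <= b -> [/\ integrable2 P (v t), \int[P]_w v t w ^+ 2 <= K &
     \int[P]_w (dsatsq e (x t w) * v t w) = 0]) ->
  s * \int[P]_w satsq e (x b w) <= s * \int[P]_w satsq e (x a w).
Proof.
move=> e01 s1 ab vK.
have e0 : 0 < e by case/andP: e01.
have s2 : s ^+ 2 = 1 by rewrite -(real_normK (num_real s)) s1 expr1n.
have mS t : measurable_fun setT (fun w => satsq e (x t w)).
  exact: (measurableT_comp (measurable_satsq e01)).
have mD t : measurable_fun setT (fun w => dsatsq e (x t w)).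
  exact: (measurableT_comp (measurable_dsatsq e01)).
have sS t : integrable1 P (fun w => satsq e (x t w)).
  apply: (le_integrable1 _ (integrable1_cst P e^-1)) => // w.
  by rewrite ger0_norm ?satsq_ge0// satsq_le.
pose K' := K / e ^+ 2.
rewrite -subr_le0 -mulrBr.
suff H (M : R) : 0 < M ->
    s * (\int[P]_w satsq e (x b w) - \int[P]_w satsq e (x a w)) <= K' * (b - a) / (4 * M).
  apply/ler_addgt0Pr => M M0; rewrite add0r.
  have [K0|K0] := ltP 0 (K' * (b - a)).
    (* This value of the drift makes the excess exactly [M]. *)
    apply: (le_trans (H (K' * (b - a) / (4 * M)) _)); first by rewrite divr_gt0// mulr_gt0.
    rewrite le_eqVlt; apply/orP; left; apply/eqP; field.
    have := gt_eqF K0; rewrite mulf_eq0 => /negbT; rewrite negb_or => /andP[-> ->].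
    by rewrite (gt_eqF M0).
  apply: (le_trans (H 1 ltr01)); rewrite (le_trans _ (ltW M0))//.
  by rewrite mulr_le0_ge0// invr_ge0.
move=> M0.
pose u t w := s * satsq e (x t w) + M * t.
pose du t w := s * (dsatsq e (x t w) * v t w) + M.
pose h t w := (s * (dsatsq e (x t w) * v t w) + 2 * M) ^+ 2 / (4 * M).
have := @Rexpectation_increment_le _ _ _ P u du h a b (M + K' / (4 * M)) ab.
have Eu t : \int[P]_w u t w = s * \int[P]_w satsq e (x t w) + M * t.
  rewrite RintegralD//; [|exact: integrable1Z|exact: integrable1_cst].
  by rewrite RintegralZl ?Rexpectation_cst//; exact: sS.
rewrite !Eu => H.
have -> : K' * (b - a) / (4 * M) = (M + K' / (4 * M)) * (b - a) - M * (b - a).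
  by field; rewrite gt_eqF.
rewrite lerBrDr; apply: le_trans _ (H _ _ _ _ _ _ _).
- by rewrite le_eqVlt; apply/orP; left; apply/eqP; ring.
- move=> w t _; have dxt := dx w t.
  have dS : is_derive t (1 : R) (satsq e \o x^~ w) (dsatsq e (x t w) * v t w).
    have dSx := is_derive_satsq e01 (x t w).
    exact: is_derive1_comp.
  have : is_derive t (1 : R) (cst s * (satsq e \o x^~ w) + cst M * id) (du t w).
    apply: is_derive_eq.
    by rewrite !fctE /du /GRing.scale/=; ring.
  exact.
- apply: measurable_funM => //; apply: measurable_funX; apply: measurable_funD => //.
  apply: measurable_funM => //; apply: measurable_funM => //.
  exact: (measurableT_comp (measurable_dsatsq e01)).
- by move=> t w; rewrite divr_ge0 ?sqr_ge0// mulr_ge0// ltW.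
- move=> t w _; rewrite /du /h ler_pdivlMr ?mulr_gt0//.
  by have := sqr_ge0 (s * (dsatsq e (x t w) * v t w)); nra.
- move=> t /vK[sv Kv v0].
  have sDv : integrable2 P (fun w => dsatsq e (x t w) * v t w).
    apply: (le_integrable2 _ (integrable2Z e^-1 sv)).
      by apply: measurable_funM => //; case: sv.
    move=> w; rewrite normrM [leRHS]normrM; apply: ler_wpM2r => //.
    exact: le_trans (dsatsq_le e01 _) (ler_norm _).
  have hE : h t = fun w => M + (s * (dsatsq e (x t w) * v t w) +
      (4 * M)^-1 * (dsatsq e (x t w) * v t w) ^+ 2).
    apply/funext => w; rewrite /h sqrrD exprMn s2 mul1r.
    by field; rewrite gt_eqF.
  have sh1 := integrable1Z s (integrable2W sDv).
  have sh2 := integrable1Z (4 * M)^-1 (proj2 sDv).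
  rewrite hE; split.
    by apply: integrable1D; [exact: integrable1_cst|exact: integrable1D].
  rewrite RintegralD//; [|exact: integrable1_cst|exact: integrable1D].
  rewrite RintegralD// Rexpectation_cst lerD2l.
  rewrite !RintegralZl//; [|exact: (proj2 sDv)|exact: (integrable2W sDv)].
  rewrite v0 mulr0 add0r mulrC ler_pM2r ?invr_gt0 ?mulr_gt0//.
  rewrite /K' ler_pdivlMr ?exprn_gt0// mulrC -RintegralZl//; last exact: (proj2 sDv).
  apply: le_trans Kv; apply: le_Rexpectation.
  + by apply: integrable1Z; exact: (proj2 sDv).
  + exact: (proj2 sv).
  + move=> w; rewrite exprMn mulrA ler_piMl ?sqr_ge0//.
    rewrite -exprMn -(expr1n _ 2) -real_normK ?num_real// lerXn2r ?nnegrE//.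
    by rewrite normrM gtr0_norm// -ler_pdivlMl// mulr1 dsatsq_le.
- by apply: integrable1D; [exact: integrable1Z|exact: integrable1_cst].
- by apply: integrable1D; [exact: integrable1Z|exact: integrable1_cst].
Qed.

Lemma satsq_expectation_eq (a b K e : R) : 0 < e <= 1 -> a <= b ->
  (forall t, a <= t <= b -> [/\ integrable2 P (v t), \int[P]_w v t w ^+ 2 <= K &
     \int[P]_w (dsatsq e (x t w) * v t w) = 0]) ->
  \int[P]_w satsq e (x a w) = \int[P]_w satsq e (x b w).
Proof.
move=> e01 ab vK; apply/eqP; rewrite eq_le.
have := @satsq_expectation_le a b K e 1 e01 (normr1 _) ab vK.
rewrite !mul1r => ->; rewrite andbT.
have := @satsq_expectation_le a b K e (- 1) e01 _ ab vK.
by rewrite !mulN1r lerN2; apply; rewrite normrN1.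
Qed.

End single_process.

(** * Finitely many processes: local Lipschitz continuity in L2 *)

Section process_family.
Context {R : realType} {d : measure_display} {T : measurableType d}.
Variables (P : probability T R) (J : finType) (x v : J -> R -> T -> R) (K : R).
Hypothesis mx : forall j t, measurable_fun setT (x j t).
Hypothesis dx : forall j w (t : R), is_derive t 1 (x j ^~ w) (v j t w).
Hypothesis x2 : forall j (t : R), 0 <= t -> integrable2 P (x j t).
Hypothesis v2 : forall j (t : R), 0 <= t -> integrable2 P (v j t).
Hypothesis orth : forall j (t : R) (phi : R -> R) (M : R), 0 <= t ->
  measurable_fun setT phi -> (forall y, `|phi y| <= M) ->
  \int[P]_w (phi (x j t w) * v j t w) = 0.
Hypothesis K0 : 0 <= K.
Hypothesis energy : forall t : R, 0 <= t ->
  \sum_j \int[P]_w v j t w ^+ 2 <= K * (1 + \sum_j \int[P]_w x j t w ^+ 2).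

(** Constant for negative times, so that the category argument, which is about
    functions on the whole line, applies. *)
Let G (t : R) : R := \sum_j \int[P]_w x j (Num.max t 0) w ^+ 2.

Let max0 (t : R) : 0 <= Num.max t 0.
Proof. by rewrite le_max lexx orbT. Qed.

Let cx j w : continuous (x j ^~ w).
Proof.
by move=> t; exact: is_derive_continuous (dx j w t).
Qed.

Let sx j (t : R) : integrable1 P (fun w => x j (Num.max t 0) w ^+ 2).
Proof. by case: (x2 j (max0 t)). Qed.

Let lscG (t k : R) : k < G t -> exists2 e : R, 0 < e & forall s, `|s - t| < e -> k < G s.
Proof.
move=> kG; apply: contrapT => noe.
have Hs (n : nat) : exists s, `|s - t| < n.+1%:R^-1 /\ G s <= k.
  apply: contrapT => nos; apply: noe; exists n.+1%:R^-1; first by rewrite invr_gt0.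
  by move=> s st; rewrite ltNge; apply/negP => Gs; apply: nos; exists s.
have [s_ Hs_] := choice Hs.
have s_t : s_ n @[n --> \oo] --> t.
  apply/cvgrPdist_lt => e e0; near=> n.
  rewrite distrC; apply: lt_trans (proj1 (Hs_ n)) _.
  by near: n; exact: (near_infty_natSinv_lt (PosNum e0)).
pose f n w := \sum_j x j (Num.max (s_ n) 0) w ^+ 2.
have [] := @Rexpectation_fatou _ _ _ P f (fun w => \sum_j x j (Num.max t 0) w ^+ 2) k.
- by move=> n; apply: integrable1_sum => j; exact: sx.
- by move=> n w; apply: sumr_ge0 => j _; exact: sqr_ge0.
- move=> w; apply: cvg_big => [|j _]; first exact: add_continuous.
  have c1 : Num.max (s_ n) 0 @[n --> \oo] --> Num.max t 0.
    apply/cvgrPdist_lt => z z0; near=> n.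
    apply: (@le_lt_trans _ _ `|t - s_ n|); last by near: n; move/cvgrPdist_lt : s_t; exact.
    have := ler_norm (t - s_ n); have := ler_norm (- (t - s_ n)); rewrite normrN => n1 n2.
    rewrite ler_norml !maxEle.
    by case: (leP t 0) => ?; case: (leP (s_ n) 0) => ?; apply/andP; split; lra.
  have c2 : x j (Num.max (s_ n) 0) w @[n --> \oo] --> x j (Num.max t 0) w.
    by apply: (cvg_comp (fun n => Num.max (s_ n) 0) (x j ^~ w) c1); exact: cx.
  exact: (cvgM c2 c2).
- by move=> n; rewrite Rexpectation_sum//; exact: (proj2 (Hs_ n)).
by move=> _; rewrite Rexpectation_sum// leNgt kG.
Unshelve. all: end_near. Qed.

Let bounded_on (a b : R) : (forall r, a <= r <= b -> bounded_near G r) ->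
  exists B, forall r, a <= r <= b -> G r <= B.
Proof.
move=> bG.
have := (@compact_near_coveringP _ `[a, b]%classic).1 (@segment_compact _ a b).
move=> /(_ R (+oo) (fun B r => G r <= B)) H.
have : \forall B \near +oo, `[a, b]%classic `<=` [set r | G r <= B].
  apply: H => r /=; rewrite in_itv/= => /bG[B [e [e0 GB]]].
  exists (ball r e, [set B' | B <= B']).
    split => /=; first exact: nbhsx_ballx.
    by exists B; split; rewrite ?num_real// => y /ltW.
  move=> -[s B'] /= [rs BB']; apply: le_trans BB'; apply: GB.
  by rewrite distrC.
move=> [B [_ HB]]; exists (B + 1) => r rab; apply: (HB (B + 1)).
  by rewrite ltrDl.
by rewrite /= in_itv.
Qed.

Let energy_bound (B t : R) j : 0 <= t -> G t <= B -> \int[P]_w v j t w ^+ 2 <= K * (1 + B).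
Proof.
move=> t0 GB; apply: (@le_trans _ _ (\sum_j \int[P]_w v j t w ^+ 2)).
  rewrite (bigD1 j)//= lerDl; apply: sumr_ge0 => i _.
  by apply: Rintegral_ge0 => w _; exact: sqr_ge0.
apply: le_trans (energy t0) _; rewrite ler_wpM2l// lerD2l.
by apply: le_trans GB; rewrite /G (max_l t0).
Qed.

Let satsq_expectation_inner (a b e : R) j : 0 < e <= 1 -> 0 <= a -> a <= b ->
  (forall r, a <= r <= b -> bounded_near G r) ->
  \int[P]_w satsq e (x j a w) = \int[P]_w satsq e (x j b w).
Proof.
move=> e01 a0 ab /bounded_on[B GB].
apply: (@satsq_expectation_eq _ _ _ P (x j) (v j) _ _ a b (K * (1 + B))) => // t tab.
have t0 : 0 <= t by case/andP: tab => /(le_trans a0).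
split; [exact: v2|by apply: energy_bound => //; exact: GB|].
by apply: (@orth j t _ e^-1) => //; [exact: measurable_dsatsq|exact: dsatsq_le].
Qed.

Let satsq_cvg (e : R) j (s_ : nat -> R) t : 0 < e <= 1 -> s_ n @[n --> \oo] --> t ->
  \int[P]_w satsq e (x j (s_ n) w) @[n --> \oo] --> \int[P]_w satsq e (x j t w).
Proof.
move=> e01 s_t.
have [] := @Rexpectation_dominated _ _ _ P (fun n w => satsq e (x j (s_ n) w))
  (fun w => satsq e (x j t w)) (fun=> e^-1) => //.
- by move=> n; exact: (measurableT_comp (measurable_satsq e01)).
- move=> w; apply: (cvg_comp s_ (satsq e \o (x j ^~ w)) s_t).
  by apply: (cvg_comp (x j ^~ w) (satsq e) (@cx j w t)); exact: continuous_satsq.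
- exact: integrable1_cst.
- by move=> n w; rewrite ger0_norm ?satsq_ge0// satsq_le.
Qed.

(** Only interior points need to be locally bounded: the truncated square is
    bounded, so its expectation is continuous up to the endpoints. *)
Let satsq_expectation_outer (a b e : R) j : 0 < e <= 1 -> 0 <= a -> a < b ->
  (forall r, a < r < b -> bounded_near G r) ->
  \int[P]_w satsq e (x j a w) = \int[P]_w satsq e (x j b w).
Proof.
move=> e01 a0 ab bG.
pose l (n : nat) := a + (b - a) / 3 * n.+1%:R^-1.
pose r (n : nat) := b - (b - a) / 3 * n.+1%:R^-1.
have n01 (n : nat) : 0 < n.+1%:R^-1 :> R /\ n.+1%:R^-1 <= 1 :> R.
  by split; rewrite ?invr_gt0// invf_le1// ler1n.
have cinv : n.+1%:R^-1 @[n --> \oo] --> (0 : R).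
  apply/cvgrPdist_lt => z z0; near=> n.
  rewrite sub0r normrN gtr0_norm; last by case: (n01 n).
  by near: n; exact: (near_infty_natSinv_lt (PosNum z0)).
have cp : (b - a) / 3 * n.+1%:R^-1 @[n --> \oo] --> (b - a) / 3 * 0.
  by apply: cvgM => //; exact: cvg_cst.
have cl : l n @[n --> \oo] --> a.
  rewrite -[X in _ --> X]addr0 -(mulr0 ((b - a) / 3)).
  by apply: cvgD => //; exact: cvg_cst.
have cr : r n @[n --> \oo] --> b.
  rewrite -[X in _ --> X]subr0 -(mulr0 ((b - a) / 3)).
  by apply: cvgB => //; exact: cvg_cst.
have lr n : \int[P]_w satsq e (x j (l n) w) = \int[P]_w satsq e (x j (r n) w).
  have [n0 n1] := n01 n.
  pose p := (b - a) / 3 * n.+1%:R^-1.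
  have p0 : 0 < p by rewrite mulr_gt0// divr_gt0// subr_gt0.
  have p1 : p <= (b - a) / 3 by rewrite ler_piMr// divr_ge0// subr_ge0 ltW.
  rewrite /l /r -/p; apply: satsq_expectation_inner => //.
  - by rewrite addr_ge0// ltW.
  - by lra.
  - by move=> z /andP[z1 z2]; apply: bG; apply/andP; split; lra.
have := @satsq_cvg e j _ _ e01 cl; under eq_fun do rewrite lr.
by move=> H; exact: (cvg_unique _ H (@satsq_cvg e j _ _ e01 cr)).
Unshelve. all: end_near. Qed.

Let sq_expectation_le (s t : R) j : 0 <= s -> 0 <= t ->
  (forall e : R, 0 < e <= 1 -> \int[P]_w satsq e (x j s w) = \int[P]_w satsq e (x j t w)) ->
  \int[P]_w x j t w ^+ 2 <= \int[P]_w x j s w ^+ 2.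
Proof.
move=> s0 t0 st.
have e01 (n : nat) : 0 < (n.+1%:R^-1 : R) <= 1 by rewrite invr_gt0/= ltr0n invf_le1// ler1n.
have mS (z e : R) : 0 < e <= 1 -> measurable_fun setT (fun w => satsq e (x j z w)).
  by move=> H; exact: (measurableT_comp (measurable_satsq H)).
have sS (z e : R) : 0 < e <= 1 -> integrable1 P (fun w => satsq e (x j z w)).
  move=> H; apply: (le_integrable1 _ (integrable1_cst P e^-1)) => [|w]; first exact: mS.
  by rewrite ger0_norm ?satsq_ge0// satsq_le.
apply: (proj2 (@Rexpectation_fatou _ _ _ P (fun n w => satsq n.+1%:R^-1 (x j t w))
  (fun w => x j t w ^+ 2) _ _ _ _ _)).
- by move=> n; exact: sS.
- by move=> n w; exact: satsq_ge0.
- move=> w; rewrite /satsq -[X in _ --> X]divr1 -[X in _ / X]addr0.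
  rewrite -[X in _ / (1 + X)](mul0r (x j t w ^+ 2)).
  apply: cvgM; first exact: cvg_cst.
  apply: cvgV; first by rewrite mul0r addr0 oner_eq0.
  apply: cvgD; first exact: cvg_cst.
  apply: cvgM; last exact: cvg_cst.
  apply/cvgrPdist_lt => z z0; near=> n.
  rewrite sub0r normrN ger0_norm//.
  by near: n; exact: (near_infty_natSinv_lt (PosNum z0)).
- move=> n; rewrite -st//; apply: le_Rexpectation; [exact: sS|by case: (x2 j s0)|].
  by move=> w; exact: satsq_le_sq.
Unshelve. all: end_near. Qed.

Let gapG (s t : R) : s < t -> (forall r, s < r < t -> bounded_near G r) -> G s = G t.
Proof.
move=> st bG; apply: eq_bigr => j _.
have [t0|t0] := ltP 0 t; last by rewrite max_r// (le_trans (ltW st)).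
have satsq_st (e : R) : 0 < e <= 1 ->
    \int[P]_w satsq e (x j (Num.max s 0) w) = \int[P]_w satsq e (x j t w).
  move=> e01; apply: satsq_expectation_outer => //; first by rewrite gt_max st.
  by move=> r /andP[]; rewrite gt_max => /andP[sr _] rt; apply: bG; rewrite sr.
apply/eqP; rewrite eq_le; apply/andP; split.
  by apply: (sq_expectation_le (ltW t0) (max0 s)) => e e01; rewrite satsq_st.
by apply: (sq_expectation_le (max0 s) (ltW t0)) => e e01; rewrite satsq_st.
Qed.

(** The second moments satisfy the hypotheses of the category argument, so the
    energy bound holds with one constant near each time. *)
Lemma locally_lipschitz_L2 (t : R) : 0 <= t -> exists C e, 0 < e /\
  forall s, 0 <= s -> `|s - t| < e ->
    forall j, \int[P]_w (x j s w - x j t w) ^+ 2 <= C * (s - t) ^+ 2.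
Proof.
move=> t0; have [B [e [e0 GB]]] := lsc_bounded_near lscG gapG t.
exists (4 * (K * (1 + B))), e; split => // s s0 st j.
have vB r : 0 <= r -> `|r - t| < e ->
    integrable2 P (v j r) /\ \int[P]_w v j r w ^+ 2 <= K * (1 + B).
  by move=> r0 rt; split; [exact: v2|apply: energy_bound => //; exact: GB].
have [ts|/ltW st'] := leP t s.
  apply: (@displacement_sq_le _ _ _ P (x j) (v j)) => //; [|exact: x2|exact: x2].
  move=> r /andP[tr rs]; apply: vB; first lra.
  by rewrite (le_lt_trans _ st)// !ger0_norm; lra.
under eq_Rintegral do rewrite -sqrrN opprB.
rewrite -[X in _ * X]sqrrN opprB.
apply: (@displacement_sq_le _ _ _ P (x j) (v j)) => //; [|exact: x2|exact: x2].
move=> r /andP[sr rt]; apply: vB; first lra.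
by rewrite (le_lt_trans _ st)// !ler0_norm; lra.
Qed.

End process_family.

(** * Orthogonality to functions of an observable *)

Import HBNNSimple.

Section orthogonality.
Context {R : realType} {d d' : measure_display} {T : measurableType d} {S : measurableType d'}.
Variables (P : probability T R) (xi : T -> S) (v : T -> R).
Hypothesis mxi : measurable_fun setT xi.
Hypothesis sv : integrable1 P v.
Hypothesis v0 : forall B, measurable B -> (\int[P]_(w in xi @^-1` B) (v w)%:E = 0)%E.

Let indic0 B : measurable B -> \int[P]_w (\1_B (xi w) * v w) = 0.
Proof.
move=> mB; have := v0 mB; rewrite integral_mkcond => H.
rewrite /Rintegral (_ : (fun w => _) = (EFin \o v) \_ (xi @^-1` B)) ?H//.
apply/funext => w; rewrite patchE indicE /=.
have [Bw|Bw] := pselect (B (xi w)); first by rewrite !mem_set// mul1r.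
by rewrite !memNset// mul0r.
Qed.

Let integrable_indic B : measurable B -> integrable1 P (fun w => \1_B (xi w) * v w).
Proof.
move=> mB; apply: (le_integrable1 _ (g := fun w => `|v w|)).
- apply: measurable_funM; last exact: integrable1_measurable sv.
  exact: (measurableT_comp (measurable_indic mB)).
- exact: (integrable_abse sv).
- move=> w; rewrite normrM ler_piMl// indicE; case: (_ \in _) => /=.
    by rewrite normr1.
  by rewrite normr0.
Qed.

Let simple0 (f : {nnsfun S >-> R}) : \int[P]_w (f (xi w) * v w) = 0.
Proof.
under eq_Rintegral do rewrite fimfunE fsbig_finite//= mulr_suml.
rewrite Rexpectation_sum; last first.
  move=> r; under eq_fun do rewrite -mulrA.
  by apply: integrable1Z; exact: integrable_indic.
rewrite big1// => r _; under eq_Rintegral do rewrite -mulrA.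
by rewrite RintegralZl// ?indic0 ?mulr0//; exact: integrable_indic.
Qed.

Let nonneg0 (phi : S -> R) : measurable_fun setT phi -> (forall s, 0 <= phi s) ->
  integrable1 P (fun w => phi (xi w) * v w) -> \int[P]_w (phi (xi w) * v w) = 0.
Proof.
move=> mphi phi0 sphi.
have mphiE : measurable_fun setT (EFin \o phi) by exact/measurable_EFinP.
pose f := nnsfun_approx measurableT mphiE.
have f_cvg s : f k s @[k --> \oo] --> phi s.
  have := @cvg_nnsfun_approx _ _ _ _ measurableT _ mphiE _ s I.
  by move=> /(_ _)/fine_cvg; apply=> x _; rewrite lee_fin.
have f_le k s : f k s <= phi s.
  rewrite -lee_fin nnsfun_approxE; apply: (le_approx (f := EFin \o phi)) => // x _.
  by rewrite lee_fin.
have [] := @Rexpectation_dominated _ _ _ P (fun k w => f k (xi w) * v w)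
  (fun w => phi (xi w) * v w) (fun w => `|phi (xi w) * v w|).
- move=> k; apply: measurable_funM; last exact: integrable1_measurable sv.
  exact: (measurableT_comp _ mxi).
- by move=> w; apply: cvgM; [exact: f_cvg|exact: cvg_cst].
- exact: (integrable_abse sphi).
- by move=> k w; rewrite !normrM ler_wpM2r// !ger0_norm.
move=> _ H; apply/esym; apply: (cvg_unique _ _ H) => //.
rewrite (_ : (fun k => _) = fun=> 0); first exact: cvg_cst.
by apply/funext => k; exact: simple0.
Qed.

(** The hypothesis says that [v] has conditional expectation 0 given [xi], tested
    on events.  It extends to nonnegative simple functions by linearity, to
    nonnegative functions by dominated convergence, and then to differences. *)
Lemma orthogonal_of_null_averages (phi : S -> R) : measurable_fun setT phi ->
  integrable1 P (fun w => phi (xi w) * v w) -> \int[P]_w (phi (xi w) * v w) = 0.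
Proof.
move=> mphi sphi.
have part (psi : S -> R) : measurable_fun setT psi -> (forall s, 0 <= psi s <= `|phi s|) ->
    integrable1 P (fun w => psi (xi w) * v w) /\ \int[P]_w (psi (xi w) * v w) = 0.
  move=> mpsi psile.
  have spsi : integrable1 P (fun w => psi (xi w) * v w).
    apply: (le_integrable1 _ (integrable_abse sphi)).
      apply: measurable_funM; last exact: integrable1_measurable sv.
      exact: (measurableT_comp mpsi).
    move=> w /=; rewrite !normrM ler_wpM2r//.
    by have /andP[p0 pp] := psile (xi w); rewrite ger0_norm.
  by split => //; apply: nonneg0 => // s; case/andP: (psile s).
have [|s|s1 i1] := part (fun s => Num.max (phi s) 0).
- exact: measurable_maxr.
- by rewrite le_max lexx orbT/= ge_max ler_norm normr_ge0.
have [|s|s2 i2] := part (fun s => Num.max (- phi s) 0).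
- by apply: measurable_maxr => //; exact: measurable_funN.
- by rewrite le_max lexx orbT/= ge_max -normrN ler_norm normr_ge0.
have -> : (fun w => phi (xi w) * v w) =
    (fun w => Num.max (phi (xi w)) 0 * v w - Num.max (- phi (xi w)) 0 * v w).
  apply/funext => w; rewrite -mulrBl; congr (_ * _).
  by rewrite !maxEle oppr_le0; case: (ltrgtP (phi (xi w)) 0) => ?; lra.
by rewrite RintegralB// i1 i2 subrr.
Qed.

End orthogonality.

(** * Differentiating the expectation of a cost *)

Section cost_along_random_points.
Context {R : realType} {d : measure_display} {T : measurableType d}.
Variables (P : probability T R) (J : finType).
Variables (c : (J -> R) -> R) (g : (J -> R) -> J -> R) (A : R).
Hypothesis c_mvt : forall y y', exists2 a : R, 0 <= a <= 1 &
  c y' - c y = \sum_j g (fun i => y i + a * (y' i - y i)) j * (y' j - y j).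
Hypothesis g_growth : forall y, \sum_j g y j ^+ 2 <= A * (1 + \sum_j y j ^+ 2).
Hypothesis g_cvg : forall (y_ : nat -> J -> R) y,
  (forall j, y_ k j @[k --> \oo] --> y j) -> forall j, g (y_ k) j @[k --> \oo] --> g y j.
Hypothesis c_measurable : forall f : J -> T -> R,
  (forall j, measurable_fun setT (f j)) -> measurable_fun setT (fun w => c (f ^~ w)).
Hypothesis A0 : 0 <= A.

Let sq_add (a b : R) : (a + b) ^+ 2 <= 2 * a ^+ 2 + 2 * b ^+ 2.
Proof. by have := sqr_ge0 (a - b); nra. Qed.

(** Young's inequality on each product of the mean value formula; the gradient is
    taken at a point of the segment, whence the displacement in both terms. *)
Lemma cost_increment_le (e : R) y y' : 0 < e ->
  `|c y' - c y| <= A / (4 * e) * (1 + 2 * \sum_j y j ^+ 2 + 2 * \sum_j (y' j - y j) ^+ 2)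
    + e * \sum_j (y' j - y j) ^+ 2.
Proof.
move=> e0; have [a /andP[a0 a1] ->] := c_mvt y y'.
pose z i := y i + a * (y' i - y i); rewrite -/z.
have e4 : 0 < (4 * e)^-1 by rewrite invr_gt0 mulr_gt0.
have -> : A / (4 * e) = (4 * e)^-1 * A by rewrite mulrC.
have split_le : `|\sum_j g z j * (y' j - y j)| <=
    (4 * e)^-1 * \sum_j g z j ^+ 2 + e * \sum_j (y' j - y j) ^+ 2.
  rewrite !mulr_sumr -big_split/=; apply: le_trans (ler_norm_sum _ _ _) _.
  apply: ler_sum => j _.
  set p := g z j; set q := y' j - y j.
  have ie : (4 * e)^-1 * (4 * e) = 1 by rewrite mulVf// mulf_neq0// gt_eqF.
  have h1 : 0 <= (4 * e)^-1 * (p - 2 * e * q) ^+ 2 by rewrite mulr_ge0 ?sqr_ge0// ltW.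
  have h2 : 0 <= (4 * e)^-1 * (p + 2 * e * q) ^+ 2 by rewrite mulr_ge0 ?sqr_ge0// ltW.
  have E1 : (4 * e)^-1 * (p - 2 * e * q) ^+ 2 = (4 * e)^-1 * p ^+ 2 + e * q ^+ 2 - p * q.
    by field; rewrite gt_eqF.
  have E2 : (4 * e)^-1 * (p + 2 * e * q) ^+ 2 = (4 * e)^-1 * p ^+ 2 + e * q ^+ 2 + p * q.
    by field; rewrite gt_eqF.
  by rewrite ler_norml; apply/andP; split; lra.
apply: le_trans split_le _; rewrite lerD2r -mulrA ler_pM2l//.
apply: le_trans (g_growth z) _; rewrite ler_wpM2l//.
rewrite -addrA lerD2l !mulr_sumr -big_split/=; apply: ler_sum => j _.
apply: le_trans (sq_add _ _) _; rewrite lerD2l ler_wpM2l// exprMn ler_piMl ?sqr_ge0//.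
by rewrite exprn_ile1.
Qed.

Lemma integrable_cost (f : J -> T -> R) : (forall j, integrable2 P (f j)) ->
  integrable1 P (fun w => c (f ^~ w)).
Proof.
move=> sf.
have s1 : integrable1 P (fun w => \sum_j (f j w) ^+ 2).
  by apply: integrable1_sum => j; case: (sf j).
have ss := integrable1D (integrable1_cst P (`|c (fun=> 0)| + A / (4 * 1)))
  (integrable1Z (A / (4 * 1) * 2 + 1) s1).
apply: (le_integrable1 _ ss); first by apply: c_measurable => j; case: (sf j).
move=> w; have := @cost_increment_le 1 (fun=> 0) (f ^~ w) ltr01.
have -> : \sum_(j in J) (0 : R) ^+ 2 = 0 by rewrite big1// => j _; rewrite expr0n.
under eq_bigr do rewrite subr0.
move=> H; rewrite -(subrK (c (fun=> 0)) (c _)); apply: le_trans (ler_normD _ _) _.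
by lra.
Qed.

(** The quotients converge pointwise but have no integrable bound: they are at
    most a fixed integrable function plus [2 B * Sd + e * Sd / h^2], where [Sd],
    the squared displacement, has expectation of order [h^2].  Truncating the
    error [Dk - D] at the fixed function [Phi] makes dominated convergence
    applicable, and the part cut off contributes at most [e * NL] in the limit,
    with [e] as small as desired. *)
Lemma cost_quotient_cvg (f_ : nat -> J -> T -> R) (f v : J -> T -> R) (h_ : nat -> R) (L : R) :
  0 <= L -> (forall k j, integrable2 P (f_ k j)) -> (forall j, integrable2 P (f j)) ->
  (forall j, integrable2 P (v j)) ->
  (forall k, h_ k != 0) -> h_ k @[k --> \oo] --> 0 ->
  (forall j w, f_ k j w @[k --> \oo] --> f j w) ->
  (forall j w, (f_ k j w - f j w) / h_ k @[k --> \oo] --> v j w) ->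
  (forall j, measurable_fun setT (fun w => g (f ^~ w) j)) ->
  (forall k j, \int[P]_w (f_ k j w - f j w) ^+ 2 <= L * h_ k ^+ 2) ->
  (\int[P]_w c (f_ k ^~ w) - \int[P]_w c (f ^~ w)) / h_ k @[k --> \oo] -->
    \int[P]_w (\sum_j g (f ^~ w) j * v j w).
Proof.
move=> L0 sf_ sf sv h0 h_cvg f_cvg q_cvg mg fL.
pose D w := \sum_j g (f ^~ w) j * v j w.
pose Dk k w := (c (f_ k ^~ w) - c (f ^~ w)) / h_ k.
have sg j : integrable2 P (fun w => g (f ^~ w) j).
  split => //; have s1 : integrable1 P (fun w => \sum_j (f j w) ^+ 2).
    by apply: integrable1_sum => i; case: (sf i).
  apply: (le_integrable1 _ (integrable1Z A (integrable1D (integrable1_cst P 1) s1))).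
    exact: measurable_funX.
  move=> w; rewrite ger0_norm ?sqr_ge0//; apply: le_trans (g_growth (f ^~ w)).
  by rewrite (bigD1 j)//= lerDl sumr_ge0// => i _; exact: sqr_ge0.
have sD : integrable1 P D by apply: integrable1_sum => j; exact: integrable2M.
have Dk_cvg w : Dk k w @[k --> \oo] --> D w.
  have mvt k : exists a : R, 0 <= a <= 1 /\ c (f_ k ^~ w) - c (f ^~ w) =
      \sum_j g (fun i => f i w + a * (f_ k i w - f i w)) j * (f_ k j w - f j w).
    by have [a a01 Ha] := c_mvt (f ^~ w) (f_ k ^~ w); exists a.
  have [a_ Ha_] := choice mvt.
  have -> : Dk^~ w = fun k => \sum_j g (fun i => f i w + a_ k * (f_ k i w - f i w)) j *
      ((f_ k j w - f j w) / h_ k).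
    apply/funext => k; rewrite /Dk (proj2 (Ha_ k)) mulr_suml.
    by apply: eq_bigr => j _; rewrite mulrA.
  apply: cvg_big => [|j _]; first exact: add_continuous.
  apply: cvgM => //; apply: g_cvg => i.
  rewrite -[X in _ --> X]addr0; apply: cvgD; first exact: cvg_cst.
  apply/cvgrPdist_le => z z0; near=> k.
  rewrite sub0r normrN normrM; apply: (@le_trans _ _ `|f_ k i w - f i w|).
    by rewrite ler_piMl//; have [/andP[? ?] _] := Ha_ k; rewrite ger0_norm.
  by rewrite distrC; near: k; move/cvgrPdist_le : (f_cvg i w); exact.
have sc_ k := integrable_cost (sf_ k).
have sc := integrable_cost sf.
have sDk k : integrable1 P (Dk k).
  rewrite /Dk; under eq_fun do rewrite mulrC.
  by apply: integrable1Z; exact: integrable1B.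
have -> : (fun k => (\int[P]_w c (f_ k ^~ w) - \int[P]_w c (f ^~ w)) / h_ k) =
    fun k => \int[P]_w Dk k w.
  apply/funext => k; rewrite /Dk RintegralZr//; last exact: integrable1B.
  by rewrite RintegralB //; exact: sc_.
apply/cvgrPdist_le => eta eta0.
pose NL : R := #|J|%:R * L.
have NL0 : 0 <= NL by rewrite mulr_ge0.
pose e := eta / (3 * (NL + 1)).
have e0 : 0 < e by rewrite divr_gt0// mulr_gt0//; lra.
pose B := A / (4 * e).
have B0 : 0 <= B by rewrite divr_ge0// mulr_ge0// ltW.
pose Sf w := \sum_j f j w ^+ 2.
pose Sd k w := \sum_j (f_ k j w - f j w) ^+ 2.
have Sf0 w : 0 <= Sf w by apply: sumr_ge0 => j _; exact: sqr_ge0.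
have Sd0 k w : 0 <= Sd k w by apply: sumr_ge0 => j _; exact: sqr_ge0.
have sSf : integrable1 P Sf by apply: integrable1_sum => j; case: (sf j).
have sdiff k j : integrable1 P (fun w => (f_ k j w - f j w) ^+ 2).
  by case: (integrable2B (sf_ k j) (sf j)).
have sSd k : integrable1 P (Sd k) by exact: integrable1_sum.
have ESd k : \int[P]_w Sd k w <= NL * h_ k ^+ 2.
  rewrite Rexpectation_sum//; apply: le_trans (ler_sum (G := fun=> L * h_ k ^+ 2) _ _) _ => //.
  by rewrite sumr_const -mulr_natl mulrA.
(* The part of the bound of [Dk - D] that does not depend on [k]. *)
pose Phi w := `|D w| + B * (1 + 2 * Sf w).
have sPhi : integrable1 P Phi.
  apply: integrable1D; first exact: (integrable_abse sD).
  by apply: integrable1Z; apply: integrable1D; [exact: integrable1_cst|exact: integrable1Z].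
have Phi0 w : 0 <= Phi w.
  by rewrite addr_ge0// mulr_ge0// addr_ge0// mulr_ge0.
have Dk_le k w : `|Dk k w| <= B * (1 + 2 * Sf w) + 2 * B * Sd k w + e * (h_ k ^- 2 * Sd k w).
  have hk0 : 0 < `|h_ k| by rewrite normr_gt0.
  (* Dividing by [h] turns the weight [e / |h|] into [e] in front of [Sd / h^2]. *)
  have := @cost_increment_le (e / `|h_ k|) (f ^~ w) (f_ k ^~ w) (divr_gt0 e0 hk0).
  rewrite -/(Sf w) -/(Sd k w) => H.
  rewrite /Dk normrM normfV ler_pdivrMr//; apply: le_trans H _.
  rewrite le_eqVlt; apply/orP; left; apply/eqP.
  rewrite -(real_normK (num_real (h_ k))) /B; field.
  by rewrite !gt_eqF.
pose m k w := Num.min `|Dk k w - D w| (Phi w).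
have sDD k : integrable1 P (fun w => `|Dk k w - D w|).
  exact: (integrable_abse (integrable1B (sDk k) sD)).
have m0 k w : 0 <= m k w by rewrite le_min normr_ge0 Phi0.
have mm k : measurable_fun setT (m k).
  apply: measurable_minr; first exact: integrable1_measurable (sDD k).
  exact: integrable1_measurable sPhi.
have [_ Em] : integrable1 P (fun=> 0) /\
    \int[P]_w m k w @[k --> \oo] --> \int[P]_w (fun=> 0) w.
  apply: (Rexpectation_dominated mm _ sPhi) => [w|k w].
    apply/cvgrPdist_le => z z0; near=> k.
    rewrite sub0r normrN ger0_norm//; apply: (@le_trans _ _ `|Dk k w - D w|).
      by rewrite ge_min lexx.
    by rewrite distrC; near: k; move/cvgrPdist_le : (Dk_cvg w); exact.
  by rewrite ger0_norm// ge_min lexx orbT.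
have sm k : integrable1 P (m k).
  apply: (le_integrable1 (mm k) sPhi) => w.
  by rewrite ger0_norm// ge_min lexx orbT.
have cf0 k : 0 <= 2 * B + e * h_ k ^- 2.
  apply: addr_ge0; first exact: mulr_ge0.
  by apply: mulr_ge0; [exact: ltW|rewrite invr_ge0 sqr_ge0].
have key k : `|\int[P]_w D w - \int[P]_w Dk k w| <=
    \int[P]_w m k w + 2 * B * NL * h_ k ^+ 2 + e * NL.
  have hk2 : 0 < h_ k ^+ 2 by rewrite exprn_even_gt0//= h0.
  rewrite distrC -RintegralB//; last exact: sDk.
  apply: le_trans (le_normr_Rintegral _ (integrable1B (sDk k) sD)) _ => //.
  apply: (@le_trans _ _ (\int[P]_w (m k w + (2 * B + e * h_ k ^- 2) * Sd k w))).
    apply: le_Rexpectation => //.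
      by apply: integrable1D => //; exact: integrable1Z.
    move=> w; rewrite /m minEle; case: (leP `|Dk k w - D w| (Phi w)) => [_|lt].
      by rewrite lerDl; apply: mulr_ge0.
    apply: le_trans (ler_normB _ _) _; have := Dk_le k w; rewrite /Phi.
    by lra.
  rewrite RintegralD//; [|exact: sm|exact: integrable1Z].
  rewrite RintegralZl//; last exact: sSd.
  rewrite -addrA lerD2l.
  apply: (@le_trans _ _ ((2 * B + e * h_ k ^- 2) * (NL * h_ k ^+ 2))).
    by rewrite ler_wpM2l.
  rewrite le_eqVlt; apply/orP; left; apply/eqP; field.
  exact: h0.
have h2_cvg : 2 * B * NL * h_ k ^+ 2 @[k --> \oo] --> 2 * B * NL * (0 * 0).
  by apply: cvgM; [exact: cvg_cst|exact: cvgM].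
have Em' : \int[P]_w m k w @[k --> \oo] --> (0 : R).
    by move: Em; rewrite Rexpectation_cst.
have h2_cvg' : 2 * B * NL * h_ k ^+ 2 @[k --> \oo] --> 0.
    by move: h2_cvg; rewrite !mulr0.
near=> k.
apply: le_trans (key k) _.
have t1 : \int[P]_w m k w <= eta / 3.
  apply: le_trans (ler_norm _) _; rewrite -[X in `|X|]subr0 distrC.
  near: k; move/cvgrPdist_le : Em'; apply; exact: divr_gt0.
have t2 : 2 * B * NL * h_ k ^+ 2 <= eta / 3.
  apply: le_trans (ler_norm _) _; rewrite -[X in `|X|]subr0 distrC.
  near: k; move/cvgrPdist_le : h2_cvg'; apply; exact: divr_gt0.
have t3 : e * NL <= eta / 3.
  have eE : e * (3 * (NL + 1)) = eta by rewrite divfK// gt_eqF// mulr_gt0//; lra.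
  by lra.
lra.
Unshelve. all: end_near. Qed.

End cost_along_random_points.

(** * Pairs of row vectors in coordinates *)

Section coordinates.
Context {R : realType} {n : nat}.
Local Notation E := 'rV[R]_n.
Local Notation J := ('I_n + 'I_n)%type.

Definition point (y : J -> R) : E * E := (\row_i y (inl i), \row_i y (inr i)).

Definition coord (z : E * E) (j : J) : R :=
  match j with inl i => z.1 0 i | inr i => z.2 0 i end.

Lemma coordK z : point (coord z) = z.
Proof. by case: z => a b; congr pair; apply/rowP => i; rewrite mxE. Qed.

Lemma pointK y j : coord (point y) j = y j.
Proof. by case: j => i; rewrite /= mxE. Qed.

Lemma point_affine (a : R) y u : point (fun j => y j + a * u j) = a *: point u + point y.
Proof. by congr pair; apply/rowP => i; rewrite !mxE addrC. Qed.

Lemma sum_coord_sq z : \sum_j coord z j ^+ 2 = enorm z.1 ^+ 2 + enorm z.2 ^+ 2.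
Proof.
rewrite big_sumType/= /enorm !sqr_sqrtr//; apply: sumr_ge0 => i _; exact: sqr_ge0.
Qed.

Lemma cvg_point (y_ : nat -> J -> R) (y : J -> R) :
  (forall j, y_ k j @[k --> \oo] --> y j) -> point (y_ k) @[k --> \oo] --> point y.
Proof.
move=> yy; apply/cvg_ballP => e e0.
have : \forall k \near \oo, forall j, ball (y j) e (y_ k j).
  by apply: filter_forall => j; move/cvg_ballP : (yy j); exact.
by apply: filterS => k yk; split; split => // i j; rewrite !mxE; exact: yk.
Qed.

(** Pairs carry the product sigma-algebra, for which open sets are not measurable
    by definition.  The pair is therefore glued into one row vector: there the
    sigma-algebra is the Borel one and measurability can be checked entrywise. *)
Lemma measurable_continuous_pair (d : measure_display) (T : measurableType d)
    (f : E * E -> R) (a b : T -> E) : continuous f ->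
  measurable_fun setT a -> measurable_fun setT b ->
  measurable_fun setT (fun w => f (a w, b w)).
Proof.
move=> cf ma mb.
pose g (u : 'rV[R]_(n + n)) := f (lsubmx u, rsubmx u).
have cg : continuous g.
  move=> u.
  have csub : continuous (fun u : 'rV[R]_(n + n) => (lsubmx u : E, rsubmx u : E)).
    move=> u0; apply: (proj2 (@cvg_ballP _ _ _ (nbhs u0) (nbhs_filter u0) _ _)) => e e0.
    apply: (filterS _ (nbhsx_ballx u0 e e0)) => u' [_ uu'].
    by split; split => // i j; rewrite !mxE; exact: uu'.
  by apply: (cvg_comp (fun u => (lsubmx u, rsubmx u)) f (csub u)); exact: cf.
have mg : measurable_fun setT g.
  apply: (measurability _ (RGenOpens.measurableE R)).
  move=> _ [_ [p [q ->]] <-]; rewrite setTI; apply: sub_sigma_algebra.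
  by apply: open_comp => [u _|]; [exact: cg|exact: interval_open].
have mu : measurable_fun setT (fun w => row_mx (a w) (b w)).
  apply: measurable_fun_mx => i j; case: (split_ordP j) => k ->.
    under eq_fun do rewrite row_mxEl.
    exact: (measurableT_comp (measurable_coord _ _)).
  under eq_fun do rewrite row_mxEr.
  exact: (measurableT_comp (measurable_coord _ _)).
have -> : (fun w => f (a w, b w)) = g \o (fun w => row_mx (a w) (b w)).
  by apply/funext => w; rewrite /g /= row_mxKl row_mxKr.
exact: measurableT_comp mg mu.
Qed.

Lemma measurable_continuous_point (d : measure_display) (T : measurableType d)
    (f : E * E -> R) (y : J -> T -> R) : continuous f ->
  (forall j, measurable_fun setT (y j)) ->
  measurable_fun setT (fun w => f (point (y ^~ w))).
Proof.
move=> cf my; apply: measurable_continuous_pair => //; apply: measurable_fun_mx => i j;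
  by under eq_fun do rewrite mxE; exact: my.
Qed.

Section gradient.
Variable c : E * E -> R.
Hypothesis c1 : C1 c.

Definition grad (z : E * E) (j : J) : R := coord (gradx c z, grady c z) j.

Lemma continuous_grad j : continuous (grad ^~ j).
Proof.
case: c1 => _ cx cy; case: j => i z; rewrite /grad /=.
  by apply: (cvg_comp (gradx c) (fun M : E => M 0 i) (cx z)); exact: coord_continuous.
by apply: (cvg_comp (grady c) (fun M : E => M 0 i) (cy z)); exact: coord_continuous.
Qed.

Lemma continuous_cost : continuous c.
Proof. by case: c1 => dc _ _ z; exact: differentiable_continuous. Qed.

Lemma derive_grad z (u : J -> R) : 'D_(point u) c z = \sum_j grad z j * u j.
Proof.
case: c1 => dc _ _.
rewrite deriveE//.
have pE : point u =
    \sum_i u (inl i) *: (delta_mx 0 i, 0) + \sum_i u (inr i) *: (0, delta_mx 0 i).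
  have Hl (f : 'I_n -> E) : (\sum_i f i, 0 : E) = \sum_i (f i, 0 : E).
    by apply: (big_morph (fun a : E => (a, 0 : E))) => // a b; congr pair; rewrite addr0.
  have Hr (f : 'I_n -> E) : (0 : E, \sum_i f i) = \sum_i (0 : E, f i).
    by apply: (big_morph (fun a : E => (0 : E, a))) => // a b; congr pair; rewrite addr0.
  have zl i : u (inl i) *: (delta_mx 0 i : E, 0 : E) = (u (inl i) *: delta_mx 0 i, 0).
    by congr pair; rewrite scaler0.
  have zr i : u (inr i) *: (0 : E, delta_mx 0 i : E) = (0, u (inr i) *: delta_mx 0 i).
    by congr pair; rewrite scaler0.
  under eq_bigr do rewrite zl.
  under [X in _ + X]eq_bigr do rewrite zr.
  rewrite -Hl -Hr /point; congr pair; rewrite /= ?addr0 ?add0r.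
    by rewrite [LHS]row_sum_delta; apply: eq_bigr => i _; rewrite mxE.
  by rewrite [LHS]row_sum_delta; apply: eq_bigr => i _; rewrite mxE.
rewrite pE linearD !linear_sum big_sumType/=; congr (_ + _);
  apply: eq_bigr => i _; rewrite linearZ /grad /= mxE mulrC deriveE//.
Qed.

Lemma cost_mvt y y' : exists2 a : R, 0 <= a <= 1 &
  c (point y') - c (point y) =
  \sum_j grad (point (fun i => y i + a * (y' i - y i))) j * (y' j - y j).
Proof.
pose u j := y' j - y j.
pose phi (a : R) := c (a *: point u + point y).
pose dphi (a : R) := \sum_j grad (point (fun i => y i + a * u i)) j * u j.
have phiD (a : R) : is_derive a 1 phi (dphi a).
  rewrite /dphi point_affine -derive_grad.
  have dcv : derivable c (a *: point u + point y) (point u).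
    by apply: diff_derivable; case: c1.
  have qE : (fun h : R => h^-1 *: ((phi \o shift a) (h *: 1) - phi a)) =
      fun h : R => h^-1 *: ((c \o shift (a *: point u + point y)) (h *: point u) -
        c (a *: point u + point y)).
    by apply/funext => h; rewrite /= /phi /shift/= scaler1 scalerDl addrA.
  by apply: DeriveDef; rewrite /derivable /derive qE.
have cphi a : {for a, continuous phi} by exact: is_derive_continuous (phiD a).
have [|a + Ha] := @MVT _ phi dphi 0 1 ltr01 (fun x _ => phiD x).
  by apply: continuous_subspaceT => x; exact: cphi.
rewrite in_itv/= => /andP[a0 a1]; exists a; first by rewrite !ltW.
move: Ha; rewrite subr0 mulr1 /dphi /phi scale1r scale0r add0r => <-.
congr (c _ - _); congr pair; apply/rowP => i; rewrite !mxE /u; ring.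
Qed.

Lemma grad_growth (C : R) :
  (forall x y, enorm (gradx c (x, y)) + enorm (grady c (x, y)) <=
     C * (1 + enorm x + enorm y)) ->
  forall y, \sum_j grad (point y) j ^+ 2 <= 3 * C ^+ 2 * (1 + \sum_j y j ^+ 2).
Proof.
move=> growth y.
have -> : \sum_j y j ^+ 2 = \sum_j coord (point y) j ^+ 2.
  by apply: eq_bigr => j _; rewrite pointK.
rewrite /grad !sum_coord_sq /=; have := growth (point y).1 (point y).2.
have e0 (x : E) : 0 <= enorm x by exact: sqrtr_ge0.
move: (e0 (gradx c (point y))) (e0 (grady c (point y))) (e0 (point y).1) (e0 (point y).2).
rewrite -surjective_pairing.
set p := enorm (gradx _ _); set q := enorm (grady _ _); set r := enorm _; set s := enorm _.
move=> p0 q0 r0 s0 H.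
apply: (@le_trans _ _ ((p + q) ^+ 2)); first by nra.
apply: (@le_trans _ _ ((C * (1 + r + s)) ^+ 2)); first by rewrite lerXn2r ?nnegrE//; lra.
have sq_le : (1 + r + s) ^+ 2 <= 3 * (1 + (r ^+ 2 + s ^+ 2)).
  by have := sqr_ge0 (1 - r); have := sqr_ge0 (1 - s); have := sqr_ge0 (r - s); nra.
rewrite exprMn; apply: le_trans (ler_wpM2l (sqr_ge0 C) sq_le) _.
by rewrite le_eqVlt; apply/orP; left; apply/eqP; ring.
Qed.

End gradient.
End coordinates.

(** * One-sided derivatives *)

Section one_sided_derivative.
Context {R : realType}.
Implicit Types f g : R -> R.

Lemma is_derive_of_nbhs f (t l : R) :
  (forall e, 0 < e -> \forall s \near t, `|f s - f t - l * (s - t)| <= e * `|s - t|) ->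
  is_derive t 1 f l.
Proof.
move=> H.
have cv : h^-1 *: ((f \o shift t) (h *: (1 : R)) - f t) @[h --> 0^'] --> l.
  apply/cvgrPdist_le => e e0; have /nbhs_ballP[d /= d0 dP] := H e e0.
  exists d => //= h /=; rewrite sub0r normrN => hd h0.
  have E1 : t - (h + t) = - h by ring.
  have E2 : h + t - t = h by ring.
  have := dP (h + t); rewrite /ball/= E1 E2 normrN scaler1 => /(_ hd) Hh.
  rewrite distrC (_ : _ - l = h^-1 * (f (h + t) - f t - l * h)); last first.
    by rewrite /GRing.scale/=; field.
  by rewrite normrM normfV ler_pdivrMl ?normr_gt0// [leRHS]mulrC.
apply: DeriveDef; first by apply/cvg_ex; exists l.
exact/cvg_lim.
Qed.

Lemma has_derive_ge0_nbhs f (t l e : R) : 0 <= t -> has_derive_ge0 f t l -> 0 < e ->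
  exists2 d : R, 0 < d & forall s, 0 <= s -> `|s - t| < d ->
    `|f s - f t - l * (s - t)| <= e * `|s - t|.
Proof.
move=> t0 /cvgrPdist_le H e0; have := H e e0.
rewrite /within/= /dnbhs/= withinE => -[U /nbhs_ballP[d /= d0 dU] UE].
exists d => // s s0 st.
have [->|nst] := eqVneq s t; first by rewrite !subrr mulr0 subrr normr0 mulr0.
have h0 : s - t != 0 by rewrite subr_eq0.
have : (U `&` (fun x => x != 0)) (s - t).
  by split => //; apply: dU; rewrite /ball /= sub0r normrN.
rewrite -UE => -[/= + _].
rewrite addrC subrK => /(_ s0).
rewrite distrC (_ : _ - l = (s - t)^-1 * (f s - f t - l * (s - t))); last first.
  by rewrite /GRing.scale/=; field.
by rewrite normrM normfV ler_pdivrMl ?normr_gt0// [leRHS]mulrC.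
Qed.

Lemma has_derive_ge0_of_seq f (t l e : R) : 0 < e ->
  (forall h : nat -> R, (forall k, h k != 0) -> (forall k, 0 <= t + h k) ->
     (forall k, `|h k| < e) -> h k @[k --> \oo] --> 0 ->
     (f (t + h k) - f t) / h k @[k --> \oo] --> l) ->
  has_derive_ge0 f t l.
Proof.
move=> e0 H; apply/cvgrPdist_le => z z0; apply: contrapT => nz.
have Hk (k : nat) : exists h : R, [/\ h != 0, 0 <= t + h, `|h| < Num.min e k.+1%:R^-1 &
    z < `|l - h^-1 *: (f (t + h) - f t)|].
  apply: contrapT => nh; apply: nz.
  have m0 : 0 < Num.min e k.+1%:R^-1 by rewrite lt_min e0/= invr_gt0.
  exists (Num.min e k.+1%:R^-1) => //= h /=; rewrite sub0r normrN => hm h0 th.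
  by rewrite leNgt; apply/negP => zh; apply: nh; exists h.
have [h_ Hh] := choice Hk.
have hcv : h_ k @[k --> \oo] --> (0 : R).
  apply/cvgrPdist_lt => y y0; near=> k.
  rewrite sub0r normrN; have [_ _ + _] := Hh k; rewrite lt_min => /andP[_ hk].
  by apply: lt_trans hk _; near: k; exact: (near_infty_natSinv_lt (PosNum y0)).
have /cvgrPdist_le/(_ _ z0)[k _ /(_ k (leqnn k))] :
    (f (t + h_ k) - f t) / h_ k @[k --> \oo] --> l.
  apply: H => // k; have [? ? + ?] := Hh k; rewrite ?lt_min//.
  by case/andP.
rewrite leNgt mulrC => /negP; apply.
by have [] := Hh k.
Unshelve. all: end_near. Qed.

Lemma is_derive_seq f (t l : R) (h : nat -> R) : is_derive t 1 f l ->
  (forall k, h k != 0) -> h k @[k --> \oo] --> 0 ->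
  (f (t + h k) - f t) / h k @[k --> \oo] --> l.
Proof.
move=> fl h0 hcv; apply/cvgrPdist_le => e e0.
have /nbhs_ballP[d /= d0 dP] := is_derive_nbhs fl e0.
near=> k.
have hd : `|h k| < d.
  rewrite -normrN -sub0r; near: k; move/cvgrPdist_lt : hcv; exact.
have E : t + h k - t = h k by ring.
have : `|f (t + h k) - f t - l * (t + h k - t)| <= e * `|t + h k - t|.
  by apply: dP; rewrite /ball/= distrC E.
rewrite E => H; rewrite distrC (_ : _ / _ - l = (f (t + h k) - f t - l * h k) / h k); last first.
  by field; rewrite h0.
by rewrite normrM normfV ler_pdivrMr ?normr_gt0.
Unshelve. all: end_near. Qed.

(** Reflecting the graph through its value at 0 keeps a one-sided derivative at 0
    and makes it two-sided, so that ordinary derivatives can be used at all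
    times. *)
Definition odd_extension f (s : R) : R := if 0 <= s then f s else 2 * f 0 - f (- s).

Lemma is_derive_odd_extension f g (t : R) :
  (forall s, 0 <= s -> has_derive_ge0 f s (g s)) ->
  is_derive t 1 (odd_extension f) (g `|t|).
Proof.
move=> fg; apply: is_derive_of_nbhs => e e0.
have [d d0 dP] := has_derive_ge0_nbhs (normr_ge0 t) (fg _ (normr_ge0 t)) e0.
have [t0|t0|t0] := ltgtP 0 t.
- apply/nbhs_ballP; exists (Num.min d t) => /=; first by rewrite lt_min d0.
  move=> s; rewrite /ball/= lt_min distrC => /andP[std stt].
  have s0 : 0 <= s by move: stt; rewrite ltr_norml => /andP[]; lra.
  rewrite /odd_extension s0 (ltW t0).
  by move: dP; rewrite gtr0_norm//; exact.
- apply/nbhs_ballP; exists (Num.min d (- t)) => /=; first by rewrite lt_min d0 oppr_gt0.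
  move=> s; rewrite /ball/= lt_min distrC => /andP[std stt].
  have s0 : s < 0 by move: stt; rewrite ltr_norml => /andP[]; lra.
  rewrite /odd_extension (leNgt 0 s) (leNgt 0 t) s0 t0/=.
  rewrite (_ : _ - _ - _ = - (f (- s) - f (- t) - g `|t| * (- s - - t))); last by ring.
  have E : - s - - t = - (s - t) by ring.
  have nsd : `|- s - - t| < d by rewrite E normrN.
  have := dP (- s); rewrite (ltr0_norm t0) => /(_ _ nsd).
  by rewrite normrN E normrN; apply; lra.
- apply/nbhs_ballP; exists d => //= s; rewrite /ball/= distrC -t0 subr0 => sd.
  move: dP; rewrite -t0 normr0 => dP.
  rewrite /odd_extension lexx; case: (leP 0 s) => s0.
    by have := dP s; rewrite subr0; exact.
  have := dP (- s); rewrite !subr0 normrN => /(_ _ sd) H.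
  rewrite (_ : _ - _ - _ = - (f (- s) - f 0 - g 0 * (- s))); last by ring.
  by rewrite normrN; apply: H; lra.
Qed.

End one_sided_derivative.

Lemma has_derive_ge0_coord (R : realType) (n : nat) (f : R -> 'rV[R]_n) (t : R)
    (l : 'rV[R]_n) i :
  has_derive_ge0 f t l -> has_derive_ge0 (fun s => f s 0 i) t (l 0 i).
Proof.
move=> H; have := cvg_comp _ (fun M : 'rV[R]_n => M 0 i) H (@coord_continuous _ _ _ 0 i l).
rewrite /has_derive_ge0; apply: cvg_trans; apply: near_eq_cvg.
by apply: nearW => h /=; rewrite !mxE.
Qed.

(** * Dissipation of the cost along the dynamics *)

Section dynamics.
Context {R : realType} {n : nat}.
Local Notation E := 'rV[R]_n.
Local Notation J := ('I_n + 'I_n)%type.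
Variables (c : E * E -> R) (d : measure_display) (T : measurableType d)
  (P : probability T R) (X Y : R -> {RV P >-> E}) (m1 m2 : R -> E -> E) (C : R).
Hypothesis c1 : C1 c.
Hypothesis growth : forall x y,
  enorm (gradx c (x, y)) + enorm (grady c (x, y)) <= C * (1 + enorm x + enorm y).
Hypothesis solution : OCD_solution c X Y m1 m2.
Hypothesis velocity2 : forall t, 0 <= t ->
  ('N[joint_law (X t) (Y t)]_2%:E[EFin \o (fun z => enorm2 (velocity c m1 m2 t z))] < +oo)%E.

Let Z t w : E * E := (X t w, Y t w).
Let X0 (j : J) (t : R) (w : T) : R := coord (Z t w) j.
Let V0 (j : J) (t : R) (w : T) : R := coord (velocity c m1 m2 t (Z t w)) j.
Let G0 (j : J) (t : R) (w : T) : R := grad c (Z t w) j.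
Let obs (j : J) (t : R) (w : T) : E := match j with inl _ => X t w | inr _ => Y t w end.
Let mean (j : J) (t : R) (x : E) : R :=
  match j with inl i => m1 t x 0 i | inr i => m2 t x 0 i end.

Let velocity_coord t z j : coord (velocity c m1 m2 t z) j =
  mean j t (match j with inl _ => z.1 | inr _ => z.2 end) - grad c z j.
Proof. by case: j => i; rewrite /velocity /grad/= !mxE addrC. Qed.

Let V0E j t w : V0 j t w = mean j t (obs j t w) - G0 j t w.
Proof. by rewrite /V0 velocity_coord; case: j. Qed.

Let mX t : measurable_fun setT (X t). Proof. exact: measurable_funP. Qed.
Let mY t : measurable_fun setT (Y t). Proof. exact: measurable_funP. Qed.

Let mobs j t : measurable_fun setT (obs j t).
Proof. by case: j. Qed.

Let mX0 j t : measurable_fun setT (X0 j t).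
Proof. by case: j => i; exact: (measurableT_comp (measurable_coord _ _)). Qed.

Let mmean j t : 0 <= t -> measurable_fun setT (mean j t).
Proof.
move=> t0; have [[m1t _ _ _] [m2t _ _ _]] := OCD_cond_exp solution t0.
by case: j => i; apply: (measurableT_comp (measurable_coord _ _)).
Qed.

Let mG0 j t : measurable_fun setT (G0 j t).
Proof. exact: (measurable_continuous_pair (@continuous_grad _ _ c c1 j) (mX t) (mY t)). Qed.

Let X0_integrable2 j t : 0 <= t -> integrable2 P (X0 j t).
Proof.
move=> t0; have [x2 y2] := OCD_square_integrable solution t0.
have sq_le (a : T -> E) i : measurable_fun setT a ->
    finite_second_moment P (fun w => enorm (a w)) -> integrable2 P (fun w => a w 0 i).
  move=> ma a2.
  have ma_ k : measurable_fun setT (fun w => a w 0 k).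
    exact: (measurableT_comp (measurable_coord _ _)).
  split => //.
  have sa : integrable1 P (fun w => \sum_k a w 0 k ^+ 2).
    apply: integrable1_ge0 => [|w|].
    - by apply: measurable_sum => k; exact: measurable_funX.
    - by apply: sumr_ge0 => k _; exact: sqr_ge0.
    - have e2 w : enorm (a w) ^+ 2 = \sum_k a w 0 k ^+ 2.
        by rewrite sqr_sqrtr// sumr_ge0// => k _; exact: sqr_ge0.
      by move: a2; rewrite /finite_second_moment; under eq_integral do rewrite e2.
  apply: (le_integrable1 _ sa); first exact: measurable_funX.
  move=> w; rewrite ger0_norm ?sqr_ge0// (bigD1 i)//= lerDl sumr_ge0// => k _.
  exact: sqr_ge0.
by case: j => i; apply: sq_le.
Qed.

Let G0_growth t w : \sum_j G0 j t w ^+ 2 <= 3 * C ^+ 2 * (1 + \sum_j X0 j t w ^+ 2).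
Proof.
have := grad_growth growth (coord (Z t w)).
by rewrite coordK.
Qed.

Let sumX0 t : 0 <= t -> integrable1 P (fun w => \sum_j X0 j t w ^+ 2).
Proof. by move=> t0; apply: integrable1_sum => j; case: (X0_integrable2 j t0). Qed.

Let G0_integrable2 j t : 0 <= t -> integrable2 P (G0 j t).
Proof.
move=> t0; split => //.
have sX := integrable1Z (3 * C ^+ 2) (integrable1D (integrable1_cst P 1) (sumX0 t0)).
apply: (le_integrable1 _ sX).
  exact: measurable_funX.
move=> w; rewrite ger0_norm ?sqr_ge0//; apply: le_trans (G0_growth t w).
by rewrite (bigD1 j)//= lerDl sumr_ge0// => k _; exact: sqr_ge0.
Qed.

Let mvelocity j t : 0 <= t ->
  measurable_fun setT (fun z : E * E => coord (velocity c m1 m2 t z) j).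
Proof.
move=> t0; under eq_fun do rewrite velocity_coord.
apply: measurable_funB.
  case: j => i.
    exact: (measurableT_comp (mmean (inl i) t0) measurable_fst).
  exact: (measurableT_comp (mmean (inr i) t0) measurable_snd).
have := measurable_continuous_pair (@continuous_grad _ _ c c1 j)
  (@measurable_fst _ _ E E) (@measurable_snd _ _ E E).
by under eq_fun do rewrite -surjective_pairing.
Qed.

Let mV0 j t : 0 <= t -> measurable_fun setT (V0 j t).
Proof.
move=> t0; apply: (measurableT_comp (mvelocity j t0)).
exact: measurable_fun_pair.
Qed.

Let V0_integrable2 j t : 0 <= t -> integrable2 P (V0 j t).
Proof.
move=> t0; split; first exact: mV0.
have sV : integrable1 P (fun w => \sum_k V0 k t w ^+ 2).
  apply: integrable1_ge0 => [|w|].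
  - by apply: measurable_sum => k; apply: measurable_funX; exact: mV0.
  - by apply: sumr_ge0 => k _; exact: sqr_ge0.
  have := poweR_lty 2 (velocity2 t0); rewrite poweR_Lnorm//.
  under eq_integral => z _.
    rewrite /= ger0_norm ?sqrtr_ge0// powR_mulrn ?sqrtr_ge0//.
    rewrite /enorm2 sqr_sqrtr ?addr_ge0 ?sqr_ge0// -sum_coord_sq.
    over.
  rewrite ge0_integral_distribution//=.
  - apply/measurable_EFinP; apply: measurable_sum => k; apply: measurable_funX.
    exact: mvelocity.
  - by move=> z; rewrite lee_fin sumr_ge0// => k _; exact: sqr_ge0.
apply: (le_integrable1 _ sV); first by apply: measurable_funX; exact: mV0.
move=> w; rewrite ger0_norm ?sqr_ge0// (bigD1 j)//= lerDl sumr_ge0// => k _.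
exact: sqr_ge0.
Qed.

Let mean_integrable2 j t : 0 <= t -> integrable2 P (fun w => mean j t (obs j t w)).
Proof.
move=> t0; rewrite (_ : (fun w => _) = fun w => V0 j t w + G0 j t w).
  by apply: integrable2D; [exact: V0_integrable2|exact: G0_integrable2].
by apply/funext => w; rewrite V0E subrK.
Qed.

(** The defining property of conditional expectations, transported from the joint
    law to the underlying probability space. *)
Let V0_null_averages j t B : 0 <= t -> measurable B ->
  (\int[P]_(w in obs j t @^-1` B) (V0 j t w)%:E = 0)%E.
Proof.
move=> t0 mB; have [cx cy] := OCD_cond_exp solution t0.
have mZ : measurable_fun setT (joint (X t) (Y t)) by exact: measurable_joint.
have mpre : measurable (obs j t @^-1` B).
  by rewrite -[X in measurable X]setTI; exact: mobs.
have smean : P.-integrable (obs j t @^-1` B) (EFin \o (fun w => mean j t (obs j t w))).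
  by apply: integrableS (integrable2W (mean_integrable2 j t0)).
have sG : P.-integrable (obs j t @^-1` B) (EFin \o G0 j t).
  by apply: integrableS (integrable2W (G0_integrable2 j t0)).
under eq_integral do rewrite V0E EFinB.
rewrite integralB_EFin//.
suff -> : (\int[P]_(w in obs j t @^-1` B) (mean j t (obs j t w))%:E =
    \int[P]_(w in obs j t @^-1` B) (G0 j t w)%:E)%E.
  by rewrite subee// integrable_fin_num.
have mgrad k : measurable_fun setT (fun z : E * E => (grad c z k)%:E).
  apply/measurable_EFinP.
  have := measurable_continuous_pair (@continuous_grad _ _ c c1 k)
    (@measurable_fst _ _ E E) (@measurable_snd _ _ E E).
  by under eq_fun do rewrite -surjective_pairing.
case: j mpre smean sG => i mpre smean sG.
  case: cx => _ _ _ /(_ i B mB).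
  rewrite (integral_pushforward mZ)//; last 2 first.
  - apply/measurable_EFinP; exact: (measurableT_comp (mmean (inl i) t0) measurable_fst).
  - by rewrite -[X in measurable X]setTI; exact: measurable_fst.
  rewrite (integral_pushforward mZ)//.
  - exact: (mgrad (inl i)).
  - by rewrite -[X in measurable X]setTI; exact: measurable_fst.
case: cy => _ _ _ /(_ i B mB).
rewrite (integral_pushforward mZ)//; last 2 first.
- apply/measurable_EFinP; exact: (measurableT_comp (mmean (inr i) t0) measurable_snd).
- by rewrite -[X in measurable X]setTI; exact: measurable_snd.
rewrite (integral_pushforward mZ)//.
- exact: (mgrad (inr i)).
- by rewrite -[X in measurable X]setTI; exact: measurable_snd.
Qed.

Let V0_orth j t (phi : E -> R) : 0 <= t -> measurable_fun setT phi ->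
  integrable1 P (fun w => phi (obs j t w) * V0 j t w) ->
  \int[P]_w (phi (obs j t w) * V0 j t w) = 0.
Proof.
move=> t0; apply: orthogonal_of_null_averages; first exact: mobs.
  exact: integrable2W (V0_integrable2 j t0).
by move=> B mB; exact: V0_null_averages.
Qed.

Let V0_orth_coord j t (phi : R -> R) (M : R) : 0 <= t -> measurable_fun setT phi ->
  (forall y, `|phi y| <= M) -> \int[P]_w (phi (X0 j t w) * V0 j t w) = 0.
Proof.
move=> t0 mphi phiM.
pose psi (x : E) : R := phi (match j with inl i => x 0 i | inr i => x 0 i end).
have psiE w : phi (X0 j t w) = psi (obs j t w) by rewrite /psi; case: (j).
have mpsi : measurable_fun setT psi.
  rewrite /psi; case: (j) => i; exact: (measurableT_comp mphi (measurable_coord _ _)).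
under eq_Rintegral do rewrite psiE.
apply: V0_orth => //; apply: integrable2M; last exact: V0_integrable2.
apply: (@integrable2_bounded _ _ _ _ M) => [|w]; last exact: phiM.
exact: measurableT_comp mpsi (mobs j t).
Qed.

(** [V0 = mean - G0] and [V0] is orthogonal to [mean], a function of the observed
    variable. *)
Let V0_energy_eq j t : 0 <= t ->
  \int[P]_w (G0 j t w * V0 j t w) = - \int[P]_w V0 j t w ^+ 2.
Proof.
move=> t0; have sMV := integrable2M (mean_integrable2 j t0) (V0_integrable2 j t0).
have sGV := integrable2M (G0_integrable2 j t0) (V0_integrable2 j t0).
have mean0 := V0_orth t0 (mmean j t0) sMV.
have -> : \int[P]_w V0 j t w ^+ 2 =
    \int[P]_w (mean j t (obs j t w) * V0 j t w - G0 j t w * V0 j t w).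
  by apply: eq_Rintegral => w _; rewrite -mulrBl -V0E.
by rewrite RintegralB// mean0 sub0r opprK.
Qed.

(** The residual [- V0 = G0 - mean] is an orthogonal projection of [G0]. *)
Let V0_energy_le j t : 0 <= t ->
  \int[P]_w V0 j t w ^+ 2 <= \int[P]_w G0 j t w ^+ 2.
Proof.
move=> t0; have [_ sV] := V0_integrable2 j t0; have [_ sG] := G0_integrable2 j t0.
have sGV := integrable2M (G0_integrable2 j t0) (V0_integrable2 j t0).
have := V0_energy_eq j t0.
have : - 2 * (\int[P]_w (G0 j t w * V0 j t w)) <=
    \int[P]_w G0 j t w ^+ 2 + \int[P]_w V0 j t w ^+ 2.
  rewrite -RintegralZl// -RintegralD//.
  apply: le_Rexpectation; [exact: integrable1Z|exact: integrable1D|].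
  by move=> w; have := sqr_ge0 (G0 j t w + V0 j t w); nra.
lra.
Qed.

Let V0_energy t : 0 <= t ->
  \sum_j \int[P]_w V0 j t w ^+ 2 <= 3 * C ^+ 2 * (1 + \sum_j \int[P]_w X0 j t w ^+ 2).
Proof.
move=> t0; apply: (@le_trans _ _ (\sum_j \int[P]_w G0 j t w ^+ 2)).
  by apply: ler_sum => j _; exact: V0_energy_le.
have sG j : integrable1 P (fun w => G0 j t w ^+ 2) by case: (G0_integrable2 j t0).
have sX j : integrable1 P (fun w => X0 j t w ^+ 2) by case: (X0_integrable2 j t0).
rewrite -Rexpectation_sum// -[in leRHS]Rexpectation_sum//.
rewrite -[X in _ * (X + _)](Rexpectation_cst P 1).
rewrite -RintegralD//; [|exact: integrable1_cst|exact: sumX0].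
rewrite -RintegralZl//; last by apply: integrable1D; [exact: integrable1_cst|exact: sumX0].
apply: le_Rexpectation => //; first exact: integrable1_sum.
by apply: integrable1Z; apply: integrable1D; [exact: integrable1_cst|exact: sumX0].
Qed.

(** The paths are modified to vanish on the null event where the equation fails
    and extended to negative times, which makes them differentiable everywhere;
    at nonnegative times no expectation changes. *)
Lemma cost_dissipation :
  (forall t, 0 <= t -> integrable1 P (fun w => c (X t w, Y t w))) /\
  forall t, 0 <= t -> exists2 l : R,
    has_derive_ge0 (fun s => \int[P]_w c (X s w, Y s w)) t l & l <= 0.
Proof.
have [N [mN PN0 HN]] := OCD_ode solution.
have ode w : ~ N w -> forall t, 0 <= t ->
    has_derive_ge0 (fun s => X s w) t (velocity c m1 m2 t (Z t w)).1 /\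
    has_derive_ge0 (fun s => Y s w) t (velocity c m1 m2 t (Z t w)).2.
  by move=> Nw; apply: contrapT => H; apply: Nw; exact: HN.
pose k w : R := \1_(~` N) w.
have mk : measurable_fun setT k by apply: measurable_indic; exact: measurableC.
have k1 w : ~ N w -> k w = 1 by move=> Nw; rewrite /k indicE mem_set.
have k0 w : N w -> k w = 0 by move=> Nw; rewrite /k indicE memNset//; apply.
have kf w y : `|k w * y| <= `|y|.
  have [/k0 ->|/k1 ->] := pselect (N w); first by rewrite mul0r normr0.
  by rewrite mul1r.
have offN f g : measurable_fun setT f -> measurable_fun setT g ->
    (forall w, ~ N w -> f w = g w) -> \int[P]_w f w = \int[P]_w g w.
  move=> mf mg fg; congr fine; apply: ae_eq_integral => //; try exact/measurable_EFinP.
  exists N; split => // w /= H; apply: contrapT => /fg fgw; apply: H => _.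
  by rewrite fgw.
pose x (j : J) (t : R) (w : T) : R := k w * odd_extension (X0 j ^~ w) t.
pose v (j : J) (t : R) (w : T) : R := k w * V0 j `|t| w.
have xE j (t : R) w : 0 <= t -> x j t w = k w * X0 j t w.
  by move=> t0; rewrite /x /odd_extension t0.
have vE j (t : R) w : 0 <= t -> v j t w = k w * V0 j t w.
  by move=> t0; rewrite /v ger0_norm.
have xN j (t : R) w : 0 <= t -> ~ N w -> x j t w = X0 j t w.
  by move=> t0 /k1 kw; rewrite xE// kw mul1r.
have vN j (t : R) w : 0 <= t -> ~ N w -> v j t w = V0 j t w.
  by move=> t0 /k1 kw; rewrite vE// kw mul1r.
have mx j (t : R) : measurable_fun setT (x j t).
  apply: measurable_funM => //; rewrite /odd_extension; case: (0 <= t) => //.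
  by apply: measurable_funB => //; exact: measurable_funM.
have mv j (t : R) : 0 <= t -> measurable_fun setT (v j t).
  by move=> t0; apply: measurable_funM => //; rewrite ger0_norm//; exact: mV0.
have dx j w (t : R) : is_derive t 1 (x j ^~ w) (v j t w).
  have [Nw|Nw] := pselect (N w).
    have -> : x j ^~ w = cst 0 by apply/funext => s; rewrite /x k0// mul0r.
    by rewrite /v k0// mul0r; exact: is_derive_cst.
  have -> : x j ^~ w = odd_extension (X0 j ^~ w).
    by apply/funext => s; rewrite /x k1// mul1r.
  rewrite /v k1// mul1r.
  apply: (is_derive_odd_extension (g := fun s => V0 j s w)) => s s0.
  have [dX dY] := ode w Nw s s0.
  by case: j => i; rewrite /X0 /V0 /=; exact: has_derive_ge0_coord.
have x2 j (t : R) : 0 <= t -> integrable2 P (x j t).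
  by move=> t0; apply: (le_integrable2 _ (X0_integrable2 j t0)) => // w; rewrite xE.
have v2 j (t : R) : 0 <= t -> integrable2 P (v j t).
  move=> t0; apply: (le_integrable2 _ (V0_integrable2 j t0)) => [|w]; first exact: mv.
  by rewrite vE.
have orth j (t : R) (phi : R -> R) (M : R) : 0 <= t -> measurable_fun setT phi ->
    (forall y, `|phi y| <= M) -> \int[P]_w (phi (x j t w) * v j t w) = 0.
  move=> t0 mphi phiM; rewrite -(V0_orth_coord j t0 mphi phiM); apply: offN.
  - apply: measurable_funM; last exact: mv.
    exact: measurableT_comp mphi (mx j t).
  - apply: measurable_funM; last exact: mV0.
    exact: measurableT_comp mphi (mX0 j t).
  - by move=> w Nw; rewrite xN// vN.
have C0 : 0 <= 3 * C ^+ 2 by rewrite mulr_ge0// sqr_ge0.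
have energy (t : R) : 0 <= t ->
    \sum_j \int[P]_w v j t w ^+ 2 <= 3 * C ^+ 2 * (1 + \sum_j \int[P]_w x j t w ^+ 2).
  move=> t0; have := V0_energy t0.
  have -> : \sum_j \int[P]_w V0 j t w ^+ 2 = \sum_j \int[P]_w v j t w ^+ 2.
    apply: eq_bigr => j _; apply: offN => [||w Nw]; last by rewrite vN.
      by apply: measurable_funX; exact: mV0.
    by apply: measurable_funX; exact: mv.
  have -> : \sum_j \int[P]_w X0 j t w ^+ 2 = \sum_j \int[P]_w x j t w ^+ 2.
    apply: eq_bigr => j _; apply: offN => [||w Nw]; last by rewrite xN.
      exact: measurable_funX.
    exact: measurable_funX.
  by [].
have mc (f : J -> T -> R) : (forall j, measurable_fun setT (f j)) ->
    measurable_fun setT (fun w => c (point (f ^~ w))).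
  exact: measurable_continuous_point (continuous_cost c1).
have scZ t : 0 <= t -> integrable1 P (fun w => c (X t w, Y t w)).
  move=> t0; have := integrable_cost (cost_mvt c1) (grad_growth growth) mc C0
    (fun j => X0_integrable2 j t0).
  by under eq_fun do rewrite coordK.
split => // t t0.
have [L [e [e0 xL]]] := locally_lipschitz_L2 mx dx x2 v2 orth C0 energy t0.
have cE s : 0 <= s -> \int[P]_w c (X s w, Y s w) = \int[P]_w c (point (fun j => x j s w)).
  move=> s0; apply: offN => [||w Nw].
  - exact: integrable1_measurable (scZ s s0).
  - by apply: mc => j; exact: mx.
  - congr c; rewrite -[LHS]coordK; congr point.
    by apply/funext => j; rewrite xN.
exists (- \sum_j \int[P]_w V0 j t w ^+ 2); last first.
  rewrite oppr_le0; apply: sumr_ge0 => j _; apply: Rintegral_ge0 => w _.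
  exact: sqr_ge0.
apply: (has_derive_ge0_of_seq e0) => h h0 th he hcv.
have mgrad j : measurable_fun setT (fun w => grad c (point (fun j => x j t w)) j).
  apply: (measurable_continuous_point (@continuous_grad _ _ c c1 j)) => i.
  exact: mx.
have limE : \int[P]_w (\sum_j grad c (point (fun j => x j t w)) j * v j t w) =
    - \sum_j \int[P]_w V0 j t w ^+ 2.
  rewrite -sumrN; under [RHS]eq_bigr do rewrite -V0_energy_eq//.
  rewrite -Rexpectation_sum; last first.
    by move=> j; apply: integrable2M; [exact: G0_integrable2|exact: V0_integrable2].
  apply: offN.
  - by apply: measurable_sum => j; apply: measurable_funM => //; exact: mv.
  - by apply: measurable_sum => j; apply: measurable_funM => //; exact: mV0.
  - move=> w Nw; apply: eq_bigr => j _; rewrite vN//; congr (_ * _).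
    rewrite /G0 -[Z t w]coordK; congr (grad c (point _) j).
    by apply/funext => i; rewrite xN.
rewrite -limE (cE _ t0).
under eq_fun do rewrite cE//.
apply: (cost_quotient_cvg (cost_mvt c1) (grad_growth growth) _ mc C0 (L := `|L|)
  (f_ := fun k j => x j (t + h k)) (f := x ^~ t) (v := v ^~ t)) => //.
- move=> y_ y yy j; apply: (cvg_comp (fun k => point (y_ k)) (grad c ^~ j)).
    exact: cvg_point.
  exact: (@continuous_grad _ _ c c1 j).
- by move=> i j; exact: x2.
- by move=> j; exact: x2.
- by move=> j; exact: v2.
- move=> j w; have cx := is_derive_continuous (dx j w t).
  have th_cvg : t + h i @[i --> \oo] --> t.
    by rewrite -[X in _ --> X]addr0; apply: cvgD => //; exact: cvg_cst.
  by apply: (cvg_comp (fun i => t + h i) (x j ^~ w) th_cvg); exact: cx.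
- by move=> j w; exact: is_derive_seq.
- move=> i j; have E1 : t + h i - t = h i by ring.
  have := xL (t + h i) (th i); rewrite E1 => /(_ (he i) j) H.
  by apply: le_trans H _; rewrite ler_wpM2r ?sqr_ge0// ler_norm.
Qed.

End dynamics.

Theorem proposition2p2 (R : realType) (n : nat)
    (c : 'rV[R]_n * 'rV[R]_n -> R)
    (mu nu : probability 'rV[R]_n R)
    (pi0 : probability ('rV[R]_n * 'rV[R]_n)%type R)
    (d : measure_display) (T : measurableType d) (P : probability T R)
    (X Y : R -> {RV P >-> 'rV[R]_n})
    (m1 m2 : R -> 'rV[R]_n -> 'rV[R]_n)
    (rho : R -> 'rV[R]_n * 'rV[R]_n -> R)
    (c_ge0 : forall z, 0 <= c z)
    (mu_P2 : finite_second_moment mu (@enorm R n))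
    (nu_P2 : finite_second_moment nu (@enorm R n))
    (pi0_coupling : Pi mu nu pi0)
    (initial : forall A, measurable A -> joint_law (X 0) (Y 0) A = pi0 A)
    (solution : OCD_solution c X Y m1 m2)
    (reg : regularity c mu nu X Y m1 m2 rho) :
  (forall t, 0 <= t ->
     P.-integrable setT (fun w => (c (X t w, Y t w))%:E)) /\
  (forall t, 0 <= t ->
     exists2 l : R,
       has_derive_ge0 (fun s => fine 'E_P[fun w => c (X s w, Y s w)]) t l &
       l <= 0).
Proof.
have [C growth] := reg_growth reg.
have velocity2 t : 0 <= t -> _ := fun t0 => proj1 (reg_velocity reg t0).
have [sc dc] := cost_dissipation (reg_C1 reg) growth solution velocity2.
split=> // t /dc[l dl l0]; exists l => //.
by under eq_fun do rewrite unlock.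
Qed.
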